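(* Let $C_s>0$, $\delta>0$, $\beta>0$, let $f\in L^\infty(0,\infty;L^2(\Omega))$, $w_0\in L^2(\Omega)$, and let $w$ be a strong solution of the corrected Smagorinsky model $$w_t+\beta^2 a(w)\frac{\partial}{\partial t}\big(a(w)w\big)+w\cdot\nabla w+\nabla p-\nabla\cdot\big([\nu+\nu_T(w)]\nabla w\big)=f,\qquad \nabla\cdot w=0\quad\text{in }\Omega\times(0,\infty),$$ $$w=0\ \text{on }\partial\Omega,\qquad w(x,0)=w_0(x)\ \text{in }\Omega,$$ where $\nu_T(w)=(C_s\delta)^2|\nabla w|$ and $a(w)=\nu^{-1/2}C_s\delta\sqrt{|\nabla w|}$. Then $$w,\ a(w)w\in L^\infty(0,\infty;L^2(\Omega)),$$ and $$\frac1T\int_0^T\Big(\int_\Omega[\nu+\nu_T(w)]\,\nabla w:\nabla w\,dx\Big)dt\le C<\infty,\qquad C\text{ independent of }T.$$ Moreover, for any generalized limit $\mathrm{LIM}$, $$\mathrm{LIM}_{T\to\infty}\frac1T\int_0^T\Big(\int_\Omega[\nu+\nu_T(w)]|\nabla w|^2dx\Big)dt=\mathrm{LIM}_{T\to\infty}\frac1T\int_0^T(f,w)\,dt .$$ Further, with $$MD(t):=\int_\Omega \beta^2a(w)\frac{\partial}{\partial t}\big(a(w)w\big)\cdot w+\nu_T(w)|\nabla w|^2\,dx,$$ one has $$0\le\liminf_{T\to\infty}\frac1T\int_0^TMD(t)\,dt\le\limsup_{T\to\infty}\frac1T\int_0^TMD(t)\,dt<\infty .$$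
   Context: $\Omega\subset\mathbb{R}^d$ ($d=2$ or $3$) is a bounded domain (regular enough for the usual function-space facts), $\nu>0$ is the constant viscosity, $w$ is a velocity field with values in $\mathbb{R}^d$ and $p$ a pressure. $\|\cdot\|$ and $(\cdot,\cdot)$ are the $L^2(\Omega)$ norm and inner product; $A:B=\sum_{i,j}A_{ij}B_{ij}$ and $|\nabla w|^2=\nabla w:\nabla w$. A generalized limit $\mathrm{LIM}_{T\to\infty}$ is a positive linear functional on bounded functions of $T\in(0,\infty)$ that agrees with the ordinary limit as $T\to\infty$ whenever the latter exists (a Banach limit). A strong solution means a solution regular enough that: $w$ vanishes on $\partial\Omega$ and $\nabla w\in L^\infty(0,T;L^3(\Omega))$ for every $T<\infty$; $a(w)w$ is differentiable in time and every term in $MD(t)$ is well defined and locally integrable on $[0,\infty)$; $t\mapsto\|w(t)\|^2$ and $t\mapsto\|a(w(t))w(t)\|^2$ are locally absolutely continuous on $[0,\infty)$ with derivatives $2(w_t,w)$ and $2(\partial_t(a(w)w),a(w)w)$ for almost every $t$; and the momentum equation may be multiplied by $w$ and integrated over $\Omega$, with the usual integrations by parts, for almost every $t$. *)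

(* Defs.v *)
From HB Require Import structures.
From mathcomp Require Import all_boot all_order all_algebra.
From mathcomp Require Import all_classical all_reals all_analysis.
Set Implicit Arguments.
Unset Strict Implicit.
Unset Printing Implicit Defensive.
Import Order.TTheory GRing.Theory Num.Theory.
Import numFieldNormedType.Exports.
Local Open Scope classical_set_scope.
Local Open Scope ring_scope.

Fact matrix_display : measure_display. Proof. exact. Qed.

Section matrix_measurable.
Context (R : realType) (m n : nat).

(* the coordinate preimages generate the Borel sets of R^(m x n) *)
Definition matrix_cylinders : set (set 'M[R]_(m, n)) :=
  [set A | exists i j (B : set R),
     measurable B /\ A = (fun M : 'M[R]_(m, n) => M i j) @^-1` B].

Let mx0 : <<s matrix_cylinders >> set0.
Proof. exact: sigma_algebra0. Qed.
Let mxC A : <<s matrix_cylinders >> A -> <<s matrix_cylinders >> (~` A).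
Proof. exact: sigma_algebraC. Qed.
Let mxU (F : (set 'M[R]_(m, n))^nat) :
  (forall i, <<s matrix_cylinders >> (F i)) ->
  <<s matrix_cylinders >> (\bigcup_i F i).
Proof. exact: sigma_algebra_bigcup. Qed.

HB.instance Definition _ := @isMeasurable.Build matrix_display
  'M[R]_(m, n) <<s matrix_cylinders >> mx0 mxC mxU.

Lemma measurable_coord i j :
  measurable_fun [set: 'M[R]_(m, n)] (fun M : 'M[R]_(m, n) => M i j).
Proof.
move=> _ B mB; rewrite setTI; apply: sub_sigma_algebra.
by exists i, j, B.
Qed.

Lemma measurable_matrixP d (T : measurableType d) (f : T -> 'M[R]_(m, n)) :
  (forall i j, measurable_fun [set: T] (fun x => f x i j)) ->
  measurable_fun [set: T] f.
Proof.
move=> mf; apply: (@measurability _ _ _ _ _ f matrix_cylinders) => //.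
move=> _ [_ [i [j [B [mB ->]]]] <-].
by have := mf i j measurableT B mB.
Qed.

End matrix_measurable.

Section lebesgue_rV.
Context (R : realType).

Definition cons_rV n (p : R * 'rV[R]_n) : 'rV[R]_n.+1 :=
  row_mx (p.1%:M : 'M[R]_1) p.2 : 'rV[R]_(1 + n).

Definition uncons_rV n (v : 'rV[R]_n.+1) : R * 'rV[R]_n :=
  (v ord0 ord0, \row_j v ord0 (lift ord0 j)).

Lemma cons_rV0 n (x : R) (v : 'rV[R]_n) i : cons_rV (x, v) i ord0 = x.
Proof.
rewrite /cons_rV /= (_ : ord0 = lshift n (ord0 : 'I_1)); last exact/val_inj.
by apply: etrans (row_mxEl _ _ _ _) _; rewrite mxE !ord1 eqxx mulr1n.
Qed.

Lemma cons_rVS n (x : R) (v : 'rV[R]_n) i j :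
  cons_rV (x, v) i (lift ord0 j) = v i j.
Proof.
rewrite /cons_rV /= (_ : lift ord0 j = rshift 1 j :> 'I_(1 + n)).
  exact: etrans (row_mxEr _ _ _ _) _.
exact/val_inj.
Qed.

Lemma cons_rVK n : cancel (@cons_rV n) (@uncons_rV n).
Proof.
move=> [x v]; rewrite /uncons_rV cons_rV0; congr pair.
by apply/rowP => j; rewrite mxE cons_rVS.
Qed.

Lemma measurable_cons_rV n : measurable_fun setT (@cons_rV n).
Proof.
apply: measurable_matrixP => i j.
have [k ->|->] := unliftP ord0 j.
  rewrite (_ : (fun p => _) = (fun M : 'rV[R]_n => M i k) \o snd).
    exact: (measurableT_comp (measurable_coord _ _) measurable_snd).
  by apply/funext => -[x v]; rewrite cons_rVS.
rewrite (_ : (fun p => _) = fst); first exact: measurable_fst.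
by apply/funext => -[x v]; rewrite cons_rV0.
Qed.

Lemma measurable_uncons_rV n : measurable_fun setT (@uncons_rV n).
Proof.
apply: measurable_fun_pair; first exact: measurable_coord.
apply: measurable_matrixP => i j; under eq_fun do rewrite mxE.
exact: measurable_coord.
Qed.

Section succ.
Context (n : nat) (mu : {sigma_finite_measure set 'rV[R]_n -> \bar R}).
Local Open Scope ereal_scope.

Definition lebesgue_rVS : set 'rV[R]_n.+1 -> \bar R :=
  pushforward ((@lebesgue_measure R) \x mu) (@cons_rV n).

Let lebesgue_rVS0 : lebesgue_rVS set0 = 0.
Proof. by rewrite /lebesgue_rVS /pushforward preimage_set0 measure0. Qed.

Let lebesgue_rVS_ge0 A : 0 <= lebesgue_rVS A.
Proof. by rewrite /lebesgue_rVS /pushforward measure_ge0. Qed.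

Let lebesgue_rVS_sigma_additive : semi_sigma_additive lebesgue_rVS.
Proof.
move=> F mF tF mUF; rewrite /lebesgue_rVS /pushforward preimage_bigcup.
have mcons A : measurable A -> measurable (@cons_rV n @^-1` A).
  by move=> mA; rewrite -[X in measurable X]setTI; exact: measurable_cons_rV.
apply: measure_semi_sigma_additive.
- by move=> k; exact: mcons.
- apply/trivIsetP => /= i j _ _ ij; rewrite -preimage_setI.
  by move/trivIsetP : tF => /(_ _ _ _ _ ij) ->//; rewrite preimage_set0.
- by rewrite -preimage_bigcup; exact: mcons.
Qed.

HB.instance Definition _ := isMeasure.Build _ _ _ lebesgue_rVS
  lebesgue_rVS0 lebesgue_rVS_ge0 lebesgue_rVS_sigma_additive.

Let lebesgue_rVS_sigma_finite : sigma_finite setT lebesgue_rVS.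
Proof.
have /sigma_finiteP[F [TF ndF Foo]] := sigma_finiteT (@lebesgue_measure R).
have /sigma_finiteP[G [TG ndG Goo]] := sigma_finiteT mu.
exists (fun k => @uncons_rV n @^-1` (F k `*` G k)).
  rewrite -preimage_bigcup (_ : \bigcup_k _ = setT) ?preimage_setT//.
  rewrite -subTset => -[x y] _.
  have [i _ Fx] : (\bigcup_i F i) x by rewrite -TF.
  have [j _ Gy] : (\bigcup_i G i) y by rewrite -TG.
  exists (maxn i j) => //; split => /=.
    by move: x Fx; exact/subsetPset/ndF/leq_maxl.
  by move: y Gy; exact/subsetPset/ndG/leq_maxr.
move=> k; have [mF Fk] := Foo k; have [mG Gk] := Goo k; split.
  rewrite -[X in measurable X]setTI; apply: measurable_uncons_rV => //.
  exact: measurableX.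
rewrite /lebesgue_rVS /pushforward -comp_preimage.
rewrite (_ : @uncons_rV n \o @cons_rV n = id); last first.
  by apply/funext => p /=; rewrite cons_rVK.
by rewrite preimage_id product_measure1E// lte_mul_pinfty// ge0_fin_numE.
Qed.

HB.instance Definition _ := Measure_isSigmaFinite.Build _ _ _
  lebesgue_rVS lebesgue_rVS_sigma_finite.

End succ.

(* Lebesgue measure on R^n, as the iterated product of the one on R; the
   one-point space R^0 has mass 1. *)
Fixpoint lebesgue_rV n : {sigma_finite_measure set 'rV[R]_n -> \bar R} :=
  match n with
  | 0 => \d_(0%R : 'rV[R]_0)
  | k.+1 => lebesgue_rVS (lebesgue_rV k)
  end.

Lemma lebesgue_rV_box n (a b : 'I_n -> R) : (forall i, a i <= b i)%R ->
  lebesgue_rV n [set v | forall i, (a i <= v ord0 i <= b i)%R] =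
  (\prod_i (b i - a i))%:E.
Proof.
have mbox k (c e : 'I_k -> R) :
    measurable [set v : 'rV[R]_k | forall i, (c i <= v ord0 i <= e i)%R].
  rewrite (_ : mkset _ = \bigcap_(i in [set: 'I_k])
      ((fun v : 'rV[R]_k => v ord0 i) @^-1` `[c i, e i])); last first.
    by apply/seteqP; split => v /= hv i; have := hv i; rewrite /= in_itv//=;
      exact.
  apply: fin_bigcap_measurable => // i _; rewrite -[X in measurable X]setTI.
  exact: measurable_coord.
elim: n a b => [|n IH] a b ab.
  rewrite big_ord0 /= diracE mem_set//; by case.
rewrite /= /lebesgue_rVS /pushforward.
rewrite (_ : _ @^-1` _ = `[a ord0, b ord0] `*`
    [set v : 'rV[R]_n | forall i,
       (a (lift ord0 i) <= v ord0 i <= b (lift ord0 i))%R]); last first.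
  apply/seteqP; split => [[x v] /= h|[x v] /= [h1 h2] i].
    split; first by have := h ord0; rewrite cons_rV0 in_itv.
    by move=> i; have := h (lift ord0 i); rewrite cons_rVS.
  have [j ->|->] := unliftP ord0 i; first by rewrite cons_rVS.
  by rewrite cons_rV0; move: h1; rewrite in_itv.
rewrite product_measure1E//; last exact: mbox.
rewrite IH//.
rewrite big_ord_recl EFinM; congr (_ * _)%E.
apply: etrans (lebesgue_measure_itv `[a ord0, b ord0]%R) _.
rewrite /= lte_fin; case: ltP => // ba.
by rewrite (@le_anti _ _ (b ord0) (a ord0)) ?subrr// ba ab.
Qed.

End lebesgue_rV.

Section matrix_norms.
Context (R : realType) (m n : nat).

(* A : B, which is the dot product when A and B are row vectors *)
Definition frob (A B : 'M[R]_(m, n)) : R := \sum_i \sum_j A i j * B i j.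

Definition fnorm (A : 'M[R]_(m, n)) : R := Num.sqrt (frob A A).

End matrix_norms.

Section spaces.
Context (R : realType) (d : nat).
Implicit Types (Omega K : set 'rV[R]_d) (I : set R) (q : nat).

Definition domain Omega := [/\ open Omega, connected Omega & Omega !=set0].

Definition Lq_norm q Omega (g : 'rV[R]_d -> R) : \bar R :=
  Lnorm (lebesgue_rV R d) (q%:R)%:E (EFin \o (g \_ Omega)).

Definition in_Lq q Omega m n (u : 'rV[R]_d -> 'M[R]_(m, n)) :=
  measurable_fun Omega u /\ (Lq_norm q Omega (@fnorm R m n \o u) < +oo)%E.

(* u in L^oo(I; L^q(Omega)) *)
Definition in_Linf_Lq I q Omega m n (u : R -> 'rV[R]_d -> 'M[R]_(m, n)) :=
  measurable_fun (I `*` Omega) (fun z : R * 'rV[R]_d => u z.1 z.2) /\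
  exists M : R, {ae @lebesgue_measure R, forall t, I t ->
    (Lq_norm q Omega (@fnorm R m n \o u t) <= M%:E)%E}.

Definition locally_integrable_on Omega (u : 'rV[R]_d -> R) :=
  measurable_fun Omega u /\
  forall K, K `<=` Omega -> compact K ->
    (\int[lebesgue_rV R d]_(x in K) `|u x|%:E < +oo)%E.

Definition locally_integrable_cyl Omega (u : R -> 'rV[R]_d -> R) :=
  measurable_fun ((`]0, +oo[ : set R) `*` Omega)
    (fun z : R * 'rV[R]_d => u z.1 z.2) /\
  forall (s T : R) K, 0 < s -> K `<=` Omega -> compact K ->
    (\int[lebesgue_measure]_(t in `[s, T])
       \int[lebesgue_rV R d]_(x in K) `|u t x|%:E < +oo)%E.

Definition partial (j : 'I_d) (phi : 'rV[R]_d -> R) : 'rV[R]_d -> R :=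
  fun x => 'D_(delta_mx ord0 j) phi x.

Definition smooth (phi : 'rV[R]_d -> R) := forall s : seq 'I_d,
  continuous (foldr partial phi s) /\
  forall j x, derivable (foldr partial phi s) x (delta_mx ord0 j).

Definition test_fun Omega (phi : 'rV[R]_d -> R) :=
  smooth phi /\
  exists K, [/\ compact K, K `<=` Omega & forall x, phi x != 0 -> K x].

Definition test_fun_time (phi : R -> R) :=
  (forall k t, derivable (derive1n k phi) t 1) /\
  exists s T : R, 0 < s /\ forall t, phi t != 0 -> s <= t <= T.

Definition weak_partial Omega (j : 'I_d) (u g : 'rV[R]_d -> R) :=
  [/\ locally_integrable_on Omega u, locally_integrable_on Omega g &
    forall phi, test_fun Omega phi ->
      \int[lebesgue_rV R d]_(x in Omega) (u x * partial j phi x) =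
      - \int[lebesgue_rV R d]_(x in Omega) (g x * phi x)].

Definition weak_grad Omega (p : 'rV[R]_d -> R) (g : 'rV[R]_d -> 'rV[R]_d) :=
  forall j, weak_partial Omega j p (fun x => g x ord0 j).

(* row i of the Jacobian is the gradient of the i-th component *)
Definition weak_jacobian Omega (u : 'rV[R]_d -> 'rV[R]_d)
    (G : 'rV[R]_d -> 'M[R]_d) :=
  forall i j, weak_partial Omega j (fun x => u x ord0 i) (fun x => G x i j).

(* h_i = sum_j d_j S_ij; only the sum has to be a function *)
Definition weak_div Omega (S : 'rV[R]_d -> 'M[R]_d)
    (h : 'rV[R]_d -> 'rV[R]_d) :=
  forall i,
  [/\ forall j, locally_integrable_on Omega (fun x => S x i j),
      locally_integrable_on Omega (fun x => h x ord0 i) &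
      forall phi, test_fun Omega phi ->
        \int[lebesgue_rV R d]_(x in Omega)
           (\sum_j S x i j * partial j phi x) =
        - \int[lebesgue_rV R d]_(x in Omega) (h x ord0 i * phi x)].

(* g is the time derivative of u in the sense of distributions: tested against
   phi(t) psi(x), which span a dense set of test functions *)
Definition weak_dt Omega (u g : R -> 'rV[R]_d -> 'rV[R]_d) :=
  forall i,
  [/\ locally_integrable_cyl Omega (fun t x => u t x ord0 i),
      locally_integrable_cyl Omega (fun t x => g t x ord0 i) &
      forall phi psi, test_fun_time phi -> test_fun Omega psi ->
        \int[lebesgue_measure]_(t in `]0, +oo[) (derive1 phi t *
          \int[lebesgue_rV R d]_(x in Omega) (u t x ord0 i * psi x)) =
        - \int[lebesgue_measure]_(t in `]0, +oo[) (phi t *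
          \int[lebesgue_rV R d]_(x in Omega) (g t x ord0 i * psi x))].

(* u in W^{1,q}_0(Omega) with Jacobian G: the usual meaning of u = 0 on the
   boundary *)
Definition zero_trace q Omega (u : 'rV[R]_d -> 'rV[R]_d)
    (G : 'rV[R]_d -> 'M[R]_d) :=
  forall i, exists phi : nat -> 'rV[R]_d -> R,
  [/\ forall k, test_fun Omega (phi k),
      Lq_norm q Omega (fun x => phi k x - u x ord0 i) @[k --> \oo] --> 0%E &
      forall j, Lq_norm q Omega (fun x => partial j (phi k) x - G x i j)
                  @[k --> \oo] --> 0%E].

End spaces.

Section real_functions.
Context (R : realType).

Definition abs_continuous (a b : R) (F : R -> R) :=
  forall e, 0 < e -> exists2 eta, 0 < eta &
    forall n (s t : 'I_n -> R),
      (forall i, [/\ a <= s i, s i <= t i & t i <= b]) ->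
      trivIset setT (fun i => `]s i, t i[%classic) ->
      \sum_i (t i - s i) < eta -> \sum_i `|F (t i) - F (s i)| < e.

Definition loc_abs_continuous (F : R -> R) :=
  forall T, 0 < T -> abs_continuous 0 T F.

Definition bounded_pos (u : R -> R) :=
  exists M, forall T, 0 < T -> `|u T| <= M.

(* LIM acts on bounded functions of T in (0, oo); the last field makes LIM u
   independent of the values of u outside (0, oo) *)
Record generalized_limit (LIM : (R -> R) -> R) : Prop := {
  LIM_linear : forall (a b : R) u v, bounded_pos u -> bounded_pos v ->
    LIM (fun T => a * u T + b * v T) = a * LIM u + b * LIM v ;
  LIM_ge0 : forall u, bounded_pos u ->
    (forall T, 0 < T -> 0 <= u T) -> 0 <= LIM u ;
  LIM_cvg : forall u l, bounded_pos u -> u T @[T --> +oo] --> l -> LIM u = l }.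

End real_functions.

Section smagorinsky.
Context (R : realType) (d : nat).
Implicit Types (Omega : set 'rV[R]_d) (nu Cs delta beta : R).
Implicit Types (G : 'M[R]_d).

Definition nuT Cs delta G : R := (Cs * delta) ^+ 2 * fnorm G.

Definition acoef nu Cs delta G : R :=
  (Num.sqrt nu)^-1 * Cs * delta * Num.sqrt (fnorm G).

Definition stress nu Cs delta G : 'M[R]_d := (nu + nuT Cs delta G) *: G.

(* (u . grad) u, where G is the Jacobian of u *)
Definition convection (u : 'rV[R]_d) G : 'rV[R]_d := u *m G^T.

Definition dissipation Omega nu Cs delta (Dw : R -> 'rV[R]_d -> 'M[R]_d)
    (t : R) : \bar R :=
  (\int[lebesgue_rV R d]_(x in Omega)
     ((nu + nuT Cs delta (Dw t x)) * frob (Dw t x) (Dw t x))%:E)%E.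

Definition power Omega (f w : R -> 'rV[R]_d -> 'rV[R]_d) (t : R) : R :=
  \int[lebesgue_rV R d]_(x in Omega) frob (f t x) (w t x).

(* dtaw stands for the time derivative of a(w) w *)
Definition MD Omega nu Cs delta beta (w : R -> 'rV[R]_d -> 'rV[R]_d)
    (Dw : R -> 'rV[R]_d -> 'M[R]_d) (dtaw : R -> 'rV[R]_d -> 'rV[R]_d)
    (t : R) : R :=
  \int[lebesgue_rV R d]_(x in Omega)
    (frob ((beta ^+ 2 * acoef nu Cs delta (Dw t x)) *: dtaw t x) (w t x) +
     nuT Cs delta (Dw t x) * fnorm (Dw t x) ^+ 2).

(* The derivatives Dw, wt, dtaw, Dp and divS of w, w, a(w) w, p and
   [nu + nuT(w)] Dw are parameters, determined a.e. by the other ones. *)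
Record strong_solution Omega nu Cs delta beta
    (f : R -> 'rV[R]_d -> 'rV[R]_d) (w0 : 'rV[R]_d -> 'rV[R]_d)
    (w : R -> 'rV[R]_d -> 'rV[R]_d) (p : R -> 'rV[R]_d -> R)
    (Dw : R -> 'rV[R]_d -> 'M[R]_d) (wt dtaw Dp divS :
      R -> 'rV[R]_d -> 'rV[R]_d) : Prop := {
  sol_Dw : {ae @lebesgue_measure R, forall t, 0 < t ->
    weak_jacobian Omega (w t) (Dw t)} ;
  sol_wt : weak_dt Omega w wt ;
  sol_dtaw :
    weak_dt Omega (fun t x => acoef nu Cs delta (Dw t x) *: w t x) dtaw ;
  sol_Dp : {ae @lebesgue_measure R, forall t, 0 < t ->
    weak_grad Omega (p t) (Dp t)} ;
  sol_divS : {ae @lebesgue_measure R, forall t, 0 < t ->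
    weak_div Omega (fun x => stress nu Cs delta (Dw t x)) (divS t)} ;

  sol_momentum : {ae @lebesgue_measure R, forall t, 0 < t ->
    {ae lebesgue_rV R d, forall x, Omega x ->
      wt t x + (beta ^+ 2 * acoef nu Cs delta (Dw t x)) *: dtaw t x +
      convection (w t x) (Dw t x) + Dp t x - divS t x = f t x}} ;
  sol_div0 : {ae @lebesgue_measure R, forall t, 0 < t ->
    {ae lebesgue_rV R d, forall x, Omega x -> \tr (Dw t x) = 0}} ;
  sol_boundary : {ae @lebesgue_measure R, forall t, 0 < t ->
    zero_trace 3 Omega (w t) (Dw t)} ;
  sol_init : {ae lebesgue_rV R d, forall x, Omega x -> w 0 x = w0 x} ;

  sol_Dw_L3 : forall T, 0 < T -> in_Linf_Lq `]0, T[ 3 Omega Dw ;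
  sol_w_L2 : forall t, 0 <= t -> in_Lq 2 Omega (w t) ;
  sol_aw_L2 : forall t, 0 <= t ->
    in_Lq 2 Omega (fun x => acoef nu Cs delta (Dw t x) *: w t x) ;

  sol_MD_dtaw : {ae @lebesgue_measure R, forall t, 0 < t ->
    (lebesgue_rV R d).-integrable Omega (fun x =>
      (frob ((beta ^+ 2 * acoef nu Cs delta (Dw t x)) *: dtaw t x)
            (w t x))%:E)} ;
  sol_MD_nuT : {ae @lebesgue_measure R, forall t, 0 < t ->
    (lebesgue_rV R d).-integrable Omega (fun x =>
      (nuT Cs delta (Dw t x) * fnorm (Dw t x) ^+ 2)%:E)} ;
  sol_MD_dtaw_loc : forall T, 0 < T ->
    (@lebesgue_measure R).-integrable `]0, T[ (fun t =>
      (\int[lebesgue_rV R d]_(x in Omega)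
         frob ((beta ^+ 2 * acoef nu Cs delta (Dw t x)) *: dtaw t x)
              (w t x))%:E) ;
  sol_MD_nuT_loc : forall T, 0 < T ->
    (@lebesgue_measure R).-integrable `]0, T[ (fun t =>
      (\int[lebesgue_rV R d]_(x in Omega)
         (nuT Cs delta (Dw t x) * fnorm (Dw t x) ^+ 2))%:E) ;

  sol_w_AC : loc_abs_continuous (fun t =>
    \int[lebesgue_rV R d]_(x in Omega) fnorm (w t x) ^+ 2) ;
  sol_aw_AC : loc_abs_continuous (fun t =>
    \int[lebesgue_rV R d]_(x in Omega)
      fnorm (acoef nu Cs delta (Dw t x) *: w t x) ^+ 2) ;
  sol_w_derive : {ae @lebesgue_measure R, forall t : R, 0 < t ->
    is_derive t (1 : R)
      (fun s => \int[lebesgue_rV R d]_(x in Omega) fnorm (w s x) ^+ 2)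
      (2 * \int[lebesgue_rV R d]_(x in Omega) frob (wt t x) (w t x))} ;
  sol_aw_derive : {ae @lebesgue_measure R, forall t : R, 0 < t ->
    is_derive t (1 : R)
      (fun s => \int[lebesgue_rV R d]_(x in Omega)
         fnorm (acoef nu Cs delta (Dw s x) *: w s x) ^+ 2)
      (2 * \int[lebesgue_rV R d]_(x in Omega)
         frob (dtaw t x) (acoef nu Cs delta (Dw t x) *: w t x))} ;

  (* the momentum equation may be multiplied by w and integrated over Omega,
     with the usual integrations by parts *)
  sol_test_integrable : {ae @lebesgue_measure R, forall t, 0 < t ->
    [/\ (lebesgue_rV R d).-integrable Omega
           (fun x => (frob (wt t x) (w t x))%:E),
        (lebesgue_rV R d).-integrable Omega
           (fun x => (frob (convection (w t x) (Dw t x)) (w t x))%:E),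
        (lebesgue_rV R d).-integrable Omega
           (fun x => (frob (Dp t x) (w t x))%:E),
        (lebesgue_rV R d).-integrable Omega
           (fun x => (frob (divS t x) (w t x))%:E) &
        (lebesgue_rV R d).-integrable Omega
           (fun x => (frob (f t x) (w t x))%:E)]} ;
  sol_ibp_convection : {ae @lebesgue_measure R, forall t, 0 < t ->
    \int[lebesgue_rV R d]_(x in Omega)
      frob (convection (w t x) (Dw t x)) (w t x) =
    - (2^-1 * \int[lebesgue_rV R d]_(x in Omega)
                (\tr (Dw t x) * fnorm (w t x) ^+ 2))} ;
  sol_ibp_pressure : {ae @lebesgue_measure R, forall t, 0 < t ->
    \int[lebesgue_rV R d]_(x in Omega) frob (Dp t x) (w t x) =
    - \int[lebesgue_rV R d]_(x in Omega) (p t x * \tr (Dw t x))} ;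
  sol_ibp_stress : {ae @lebesgue_measure R, forall t, 0 < t ->
    \int[lebesgue_rV R d]_(x in Omega) frob (divS t x) (w t x) =
    - \int[lebesgue_rV R d]_(x in Omega)
        frob (stress nu Cs delta (Dw t x)) (Dw t x)} }.

End smagorinsky.

(* Main.v *)
Require Import Defs.
From HB Require Import structures.
From mathcomp Require Import all_boot all_order all_algebra.
From mathcomp Require Import all_classical all_reals all_analysis.
From mathcomp Require Import measurable_realfun ring lra.
Set Implicit Arguments.
Unset Strict Implicit.
Unset Printing Implicit Defensive.
Import Order.TTheory GRing.Theory Num.Theory.
Import numFieldNormedType.Exports.
Local Open Scope classical_set_scope.
Local Open Scope ring_scope.

(** The proof is the energy method. Testing the momentum equation with w
    kills the convection and pressure terms and gives, for almost every t,

      E'(t) + D(t) = P(t),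
      E = |w|^2 / 2 + beta^2 |a(w) w|^2 / 2,
      D = int (nu + nu_T) |grad w|^2,   P = (f, w),

    because beta^2 (a d/dt (a w), w) is half the derivative of
    beta^2 |a w|^2 (momentum_balance, energy_derive).

    The point that needs an idea is that E is bounded uniformly in time,
    although it contains |a(w) w|^2, which is a multiple of
    int |grad w| |w|^2. Both parts of E are controlled by the L^3 norm of the
    gradient: x y^2 <= x^3 + y^3 and y^2 <= 1 + y^3 reduce them to
    int |grad w|^3 and int |w|^3, and Poincare's inequality in L^3 reduces
    the latter to the former. Since nu_T |grad w|^2 is a multiple of
    |grad w|^3, this gives E <= a + b D (poincare_zero_trace,
    dissipation_cube_bounds). By Young's inequality P <= K + D / 2, hence
    E' <= K' - c E, and E never exceeds the larger of E(0) and K' / c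
    (energy_bounded, abs_continuous_absorbing).

    Everything else follows from E(T) - E(0) = int_0^T (P - D)
    (energy_balance). Dividing by T bounds the average of D for T >= 1,
    while for T <= 1 the bound comes from grad w in L^oo(0, 1; L^3); since
    (E(T) - E(0)) / T tends to 0, generalized limits of the averages of D
    and P agree. The average of MD is
    beta^2 / 2 (|a w|^2(T) - |a w|^2(0)) / T plus the average of the
    nonnegative quantity int nu_T |grad w|^2 <= D (MD_integral), whence the
    bounds on its lower and upper limits.

    As the energies are only absolutely continuous, with derivatives known
    almost everywhere, monotonicity and the fundamental theorem of calculus
    are needed in that generality (abs_continuous_nonincreasing,
    abs_continuous_FTC). *)

(** * Absolutely continuous functions of one variable *)

(** Compactness of [a, b] in inductive form: steps whose admissible length
    depends on the point, without a uniform lower bound, still reach b. *)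
Lemma cousin_induction (R : realType) (a b : R) (P : R -> Prop) :
  a <= b -> P a ->
  (forall x, a <= x <= b -> exists2 e, 0 < e &
     forall u v, a <= u -> x - e < u -> u <= x -> x <= v -> v < x + e ->
       v <= b -> P u -> P v) ->
  P b.
Proof.
move=> ab Pa step.
pose S := [set x | a <= x <= b /\ P x].
have Sa : S a by split=> //; rewrite lexx.
have ubS : ubound S b by move=> x [/andP[]].
have supS : has_sup S by split; [exists a|exists b].
set c := sup S.
have ac : a <= c by apply: ub_le_sup => //; exists b.
have cb : c <= b by apply: ge_sup => //; exists a.
have [e e0 he] : exists2 e, 0 < e &
    forall u v, a <= u -> c - e < u -> u <= c -> c <= v -> v < c + e ->
      v <= b -> P u -> P v by apply: step; rewrite ac.
have [u [/andP[au ub] Pu] ceu] := sup_adherent e0 supS.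
have uc : u <= c by apply: ub_le_sup => //; [exists b|split=> //; rewrite au].
have [bc|cltb] := leP b c.
  by apply: (he u b) => //; apply: le_lt_trans bc _; rewrite ltrDl.
have [bce|ceb] := ltP b (c + e).
  exact: (he u b).
have Sv : S (c + e / 2).
  split; first by lra.
  by apply: (he u) => //; lra.
have : c + e / 2 <= c by apply: ub_le_sup => //; exists b.
by move=> ?; lra.
Qed.

(** The derivative at the single point x controls the increments of F over
    the small intervals that contain x, and no others; this is the form of
    step that cousin_induction can glue together. *)
Lemma is_derive_le0_straddle (R : realType) (F : R -> R) (x l e : R) :
  0 < e -> l <= 0 -> is_derive x 1 F l ->
  exists2 r, 0 < r & forall u v, x - r < u -> u <= x -> x <= v -> v < x + r ->
    F v - F u <= e * (v - u).
Proof.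
move=> e0 l0 [dF Fl].
have cvF : (fun h : R => h^-1 *: ((F \o shift x) (h *: 1) - F x)) @ 0^' --> l.
  by rewrite -Fl; exact: dF.
have /cvgrPdist_lt/(_ e e0)[r /= r0 hr] := cvF.
have slope y : `|y - x| < r -> y != x -> (F y - F x) / (y - x) < e.
  move=> yxr yx; have := hr (y - x); rewrite /= sub0r normrN subr_eq0.
  move=> /(_ yxr yx); rewrite [_ *: 1]mulr1 subrK ltr_norml => /andP[+ _].
  by rewrite /GRing.scale/= [_^-1 * _]mulrC; lra.
exists r => // u v xru ux xv vxr.
have Fv : F v - F x <= e * (v - x).
  have [->|vx] := eqVneq v x; first by rewrite !subrr mulr0.
  rewrite -ler_pdivrMr; last by rewrite subr_gt0 lt_neqAle eq_sym vx.
  by apply: ltW; apply: slope => //; rewrite ger0_norm; lra.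
have Fu : F x - F u <= e * (x - u).
  have [->|ux'] := eqVneq u x; first by rewrite !subrr mulr0.
  rewrite -ler_pdivrMr; last by rewrite subr_gt0 lt_neqAle ux'.
  rewrite -mulrNN -invrN !opprB.
  by apply: ltW; apply: slope => //; rewrite ler0_norm; lra.
by lra.
Qed.

Lemma sum_itv_length_le (R : realType) (U : set R) n (s t : 'I_n -> R) :
  measurable U -> (forall i, s i <= t i) ->
  (forall i, `]s i, t i[ `<=` U) ->
  trivIset setT (fun i => `]s i, t i[%classic) ->
  ((\sum_i (t i - s i))%:E <= lebesgue_measure U)%E.
Proof.
move=> mU st sU tr.
have -> : (\sum_i (t i - s i))%:E =
    lebesgue_measure (\big[setU/set0]_(i < n) `]s i, t i[%classic).
  rewrite measure_bigsetU_ord // -sumEFin; apply: eq_bigr => i _.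
  apply: etrans (esym (lebesgue_measure_itv `]s i, t i[)); rewrite /= lte_fin.
  by case: ltgtP (st i) => // -> _; rewrite subrr.
apply: le_measure; rewrite ?inE //; first exact: bigsetU_measurable.
apply: (big_ind (fun A => A `<=` U)) => // A B AU BU.
by rewrite subUset.
Qed.

(** Monotonicity for absolutely continuous functions. Around a point where
    the derivative exists, increments are at most e times the length; the other
    points lie in an open set U so small that the total variation of F over
    disjoint intervals inside U is below e. Gluing local estimates over [a, b]
    bounds F b - F a by e * (b - a) + e. *)
Lemma abs_continuous_nonincreasing (R : realType) (a b : R) (F : R -> R) :
  a <= b -> abs_continuous a b F ->
  {ae @lebesgue_measure R, forall t, a < t < b ->
     exists2 l, l <= 0 & is_derive t 1 F l} ->
  F b <= F a.
Proof.
move=> ab acF [N [mN N0 badN]].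
have main e : 0 < e -> F b - F a <= e * (b - a) + e.
  move=> e0; have [eta eta0 hF] := acF e e0.
  pose N' := N `|` [set a] `|` [set b].
  have mN' : measurable N' by do 2 (apply: measurableU => //).
  have N'0 : lebesgue_measure N' = 0%E.
    have : (lebesgue_measure N' <= lebesgue_measure N +
        lebesgue_measure [set a] + lebesgue_measure [set b])%E.
      apply: le_trans; first by apply: measureU2 => //; apply: measurableU.
      by apply: leeD => //; apply: measureU2.
    rewrite N0 !lebesgue_measure_set1 !adde0 => N'le0.
    by apply/eqP; rewrite eq_le N'le0 measure_ge0.
  have [U [oU N'U Ueta]] : exists U : set R,
      [/\ open U, N' `<=` U & (lebesgue_measure (U `\` N') < eta%:E)%E].
    have N'oo : (lebesgue_measure N' < +oo)%E by rewrite N'0 ltry.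
    exact: (lebesgue_regularity_outer mN' N'oo eta0).
  have mU : measurable U by exact: open_measurable.
  have {}Ueta : (lebesgue_measure U < eta%:E)%E.
    apply: le_lt_trans Ueta; rewrite -[leRHS]add0e -N'0 -[in leLHS](setDUK N'U).
    by apply: measureU2 => //; exact: measurableD.
  (* P x: the rise of F over [a, x] is paid for by the slope e, except for
     the oscillation of F over finitely many disjoint intervals inside U. *)
  pose P x := exists n (s t : 'I_n -> R),
    [/\ forall i, [/\ a <= s i, s i <= t i & t i <= x],
        forall i, `]s i, t i[ `<=` U,
        trivIset setT (fun i => `]s i, t i[%classic) &
        F x - F a <= e * (x - a) + \sum_i `|F (t i) - F (s i)|].
  suff [n [s [t [ast stU tr hb]]]] : P b.
    apply: le_trans hb _; rewrite lerD2l; apply: ltW; apply: hF => //.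
    rewrite -lte_fin; apply: le_lt_trans Ueta.
    by apply: sum_itv_length_le => // i; have [] := ast i.
  apply: (@cousin_induction _ a b) => //.
    exists 0%N, (fun=> a), (fun=> a); split; [by case|by case| |].
      by move=> [].
    by rewrite !subrr mulr0 big_ord0 addr0.
  move=> x /andP[ax xb]; have [N'x|nN'x] := pselect (N' x).
    have /nbhs_ballP[r /= r0 rU] : nbhs x U.
      by rewrite nbhsE; exists U => //; split => //; exact: N'U.
    exists r => // u v au xru ux xv vxr vb [n [s [t [ast stU tr hu]]]].
    (* x is exceptional: [u, v] lies in U and is added to the family *)
    exists n.+1, (fun i => if unlift ord_max i is Some j then s j else u),
      (fun i => if unlift ord_max i is Some j then t j else v).
    split.
    - move=> i; case: unliftP => [j|] _; last by split; lra.
      by have [h1 h2 h3] := ast j; split => //; lra.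
    - move=> i; case: unliftP => [j|] _; first exact: stU.
      move=> y /=; rewrite in_itv/= => /andP[uy yv]; apply: rU.
      by rewrite /ball/= ltr_distlC; apply/andP; split; lra.
    - have far j y : `]s j, t j[%classic y -> `]u, v[%classic y -> False.
        have [_ _ tu] := ast j; rewrite /= !in_itv/= => /andP[_ yt] /andP[uy _].
        by lra.
      move=> i j _ _; case: unliftP => [i' ->|->]; case: unliftP => [j' ->|->] //.
      + by move=> /(tr _ _ I I) ->.
      + by move=> [y [yi yv]]; case: (far _ _ yi yv).
      + by move=> [y [yv yi]]; case: (far _ _ yi yv).
    - rewrite big_ord_recr/= unlift_none.
      under eq_bigr => i _.
        rewrite (_ : widen_ord _ i = lift ord_max i) ?liftK; last first.
          by apply: val_inj => /=; rewrite /bump leqNgt ltn_ord.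
        over.
      have := ler_norm (F v - F u).
      have : 0 <= e * (v - u) by apply: mulr_ge0; lra.
      by move: hu; lra.
  have [] : exists2 l, l <= 0 & is_derive x 1 F l.
    apply: contrapT => nl; apply: nN'x.
    have [->|xb'] := eqVneq x b; first by right.
    left; have [->|xa'] := eqVneq x a; first by right.
    left; apply: badN => /= h; apply: nl; apply: h.
    by rewrite !lt_neqAle ax xb xb' eq_sym xa'.
  move=> l l0 /(is_derive_le0_straddle e0 l0)[r r0 hr].
  exists r => // u v au xru ux xv vxr vb [n [s [t [ast stU tr hu]]]].
  exists n, s, t; split => //.
    by move=> i; have [h1 h2 h3] := ast i; split => //; lra.
  by have := hr u v xru ux xv vxr; move: hu; lra.
rewrite -subr_le0; apply/ler_addgt0Pl => e e0; rewrite addr0.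
have d0 : 0 < b - a + 1 by lra.
apply: le_trans (main (e / (b - a + 1)) _) _; first exact: divr_gt0.
by rewrite -[X in _ + X]mulr1 -mulrDr divfK ?gt_eqF.
Qed.

(** * Almost everywhere reasoning *)

Section almost_everywhere.
Context d (T : measurableType d) (R : realType).
Variable mu : {measure set T -> \bar R}.

Let ae_filter : Filter (almost_everywhere mu).
Proof. exact: (ae_filter_ringOfSetsType mu). Qed.

Lemma ae_imp (P Q : T -> Prop) : (forall x, P x -> Q x) ->
  {ae mu, forall x, P x} -> {ae mu, forall x, Q x}.
Proof. exact: (@filterS _ _ ae_filter). Qed.

Lemma ae_imp2 (P1 P2 Q : T -> Prop) : (forall x, P1 x -> P2 x -> Q x) ->
  {ae mu, forall x, P1 x} -> {ae mu, forall x, P2 x} ->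
  {ae mu, forall x, Q x}.
Proof. exact: (@filterS2 _ _ ae_filter). Qed.

Lemma ae_and (P1 P2 : T -> Prop) :
  {ae mu, forall x, P1 x} -> {ae mu, forall x, P2 x} ->
  {ae mu, forall x, P1 x /\ P2 x}.
Proof. exact: ae_imp2. Qed.

End almost_everywhere.

(** * Absorbing sets and the fundamental theorem of calculus *)

Lemma abs_continuousS (R : realType) (a b a' b' : R) (F : R -> R) :
  a <= a' -> b' <= b -> abs_continuous a b F -> abs_continuous a' b' F.
Proof.
move=> aa' bb' acF e e0; have [eta eta0 hF] := acF e e0.
exists eta => // n s t st; apply: hF => i.
by have [h1 h2 h3] := st i; split => //; lra.
Qed.

Lemma abs_continuousD (R : realType) (a b c e : R) (F G : R -> R) :
  abs_continuous a b F -> abs_continuous a b G ->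
  abs_continuous a b (fun t => c * F t + e * G t).
Proof.
move=> acF acG r r0.
pose M := `|c| + `|e| + 1.
have M0 : 0 < M by rewrite /M; have := normr_ge0 c; have := normr_ge0 e; lra.
have r'0 : 0 < r / M by exact: divr_gt0.
have [eta1 eta10 hF] := acF _ r'0; have [eta2 eta20 hG] := acG _ r'0.
exists (Num.min eta1 eta2); first by rewrite lt_min eta10.
move=> n s t st tr; rewrite lt_min => /andP[/(hF _ _ _ st tr) h1].
move=> /(hG _ _ _ st tr) h2.
apply: (@le_lt_trans _ _ (`|c| * \sum_i `|F (t i) - F (s i)| +
    `|e| * \sum_i `|G (t i) - G (s i)|)).
  rewrite !mulr_sumr -big_split/=; apply: ler_sum => i _.
  rewrite -!normrM; apply: le_trans (ler_normD _ _).
  by rewrite le_eqVlt; apply/orP; left; apply/eqP; congr `|_|; ring.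
apply: (@le_lt_trans _ _ ((`|c| + `|e|) * (r / M))).
  by rewrite mulrDl; apply: lerD; apply: ler_wpM2l => //; exact: ltW.
rewrite mulrCA gtr_pMr// ltr_pdivrMr// mul1r /M; lra.
Qed.

Lemma abs_continuous_modulus (R : realType) (a b e : R) (F : R -> R) :
  abs_continuous a b F -> 0 < e ->
  exists2 eta, 0 < eta & forall s t, a <= s -> s <= t -> t <= b ->
    t - s < eta -> `|F t - F s| < e.
Proof.
move=> acF e0; have [eta eta0 hF] := acF e e0; exists eta => // s t as_ st tb h.
have := hF 1%N (fun=> s) (fun=> t); rewrite !big_ord1; apply => //.
by move=> i j _ _; rewrite !ord1.
Qed.

(** Above the level K / c the derivative is negative, so E cannot leave
    the sublevel set of max (E 0) (K / c): after the last time spent in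
    that set, E would be nonincreasing. *)
Lemma abs_continuous_absorbing (R : realType) (E : R -> R) (K c : R) :
  0 < c -> loc_abs_continuous E ->
  {ae @lebesgue_measure R, forall t : R, 0 < t ->
     exists2 l, is_derive t 1 E l & l <= K - c * E t} ->
  forall t, 0 <= t -> E t <= Num.max (E 0) (K / c).
Proof.
move=> c0 acE dE t1 t10; set M := Num.max _ _.
have [//|ME] := leP (E t1) M.
have {}t10 : 0 < t1.
  rewrite lt_neqAle t10 andbT; apply/eqP => t1E; move: ME.
  by rewrite -t1E /M gt_max ltxx.
have ac1 := acE _ t10.
pose S := [set s | 0 <= s <= t1 /\ E s <= M].
have S0 : S 0 by split; [rewrite lexx ltW|rewrite le_max lexx].
have ubS : ubound S t1 by move=> x [/andP[]].
have supS : has_sup S by split; [exists 0|exists t1].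
set s := sup S.
have s0 : 0 <= s by apply: ub_le_sup => //; exists t1.
have st1 : s <= t1 by apply: ge_sup => //; exists 0.
have EsM : E s <= M.
  rewrite leNgt; apply/negP => MEs.
  have d0 : 0 < E s - M by rewrite subr_gt0.
  have [eta eta0 hE] := abs_continuous_modulus ac1 d0.
  have [u [/andP[u0 ut1] EuM] seu] := sup_adherent eta0 supS.
  have us : u <= s by apply: ub_le_sup; [exists t1|split=> //; rewrite u0].
  have : `|E s - E u| < E s - M by apply: hE => //; rewrite /s; lra.
  by rewrite ltr_norml => /andP[_]; lra.
have : E t1 <= E s.
  apply: abs_continuous_nonincreasing => //.
    exact: abs_continuousS ac1.
  apply: ae_imp dE => /= t ht /andP[st tt1].
  have [l dl lK] := ht (le_lt_trans s0 st); exists l => //; apply: le_trans lK _.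
  have MEt : M < E t.
    rewrite ltNge; apply/negP => EtM.
    have : t <= s.
      apply: ub_le_sup; [by exists t1|split=> //].
      by rewrite (ltW (le_lt_trans s0 st)) ltW.
    by rewrite leNgt st.
  have : K / c <= M by rewrite /M le_max lexx orbT.
  by rewrite ler_pdivrMr// => KM; rewrite subr_le0 (le_trans KM)// mulrC ler_pM2l// ltW.
by move=> /le_trans/(_ EsM); rewrite leNgt ME.
Qed.

Lemma abs_continuous_integral (R : realType) (g : R -> R) (a b : R) :
  (@lebesgue_measure R).-integrable setT (EFin \o g) ->
  abs_continuous a b (fun y => \int[lebesgue_measure]_(x in `]-oo, y]) g x).
Proof.
move=> ig e e0.
have [eta [eta0 hg]] := integral_normr_continuous ig e0.
exists eta => // n s t st tr sum_lt.
have mI i : measurable (`]s i, t i[%classic : set (measurableTypeR R)).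
  exact: measurable_itv.
pose D : set (measurableTypeR R) := \big[setU/set0]_(i <- index_enum 'I_n) `]s i, t i[%classic.
have mD : measurable D by exact: bigsetU_measurable.
have igN : (@lebesgue_measure R).-integrable setT (fun x => `|g x|%:E).
  exact: (integrable_abse ig).
have igS (A : set (measurableTypeR R)) : measurable A ->
    (@lebesgue_measure R).-integrable A (EFin \o g).
  by move=> mA; apply: integrableS ig.
have igNS (A : set (measurableTypeR R)) : measurable A ->
    (@lebesgue_measure R).-integrable A (fun x => `|g x|%:E).
  by move=> mA; apply: integrableS igN.
have -> : \sum_i `|\int[lebesgue_measure]_(x in `]-oo, t i]) g x -
      \int[lebesgue_measure]_(x in `]-oo, s i]) g x| =
    \sum_i `|\int[lebesgue_measure]_(x in `]s i, t i[) g x|.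
  apply: eq_bigr => i _; have [_ sti _] := st i.
  rewrite Rintegral_itvB//; last exact: igS.
  by rewrite Rintegral_itv_bndo_bndc//; exact: igS.
apply: (@le_lt_trans _ _ (\int[lebesgue_measure]_(x in D) `|g x|)).
  rewrite -lee_fin fineK; last exact: (integrable_fin_num mD (igNS _ mD)).
  rewrite integral_bigsetU_EFin//; last first.
  - by have /integrableP[] := igNS D mD.
  - exact: sub_trivIset tr.
  - exact: index_enum_uniq.
  rewrite -sumEFin; apply: lee_sum => i _.
  rewrite -[leRHS]fineK; last exact: (integrable_fin_num (mI i) (igNS _ (mI i))).
  by rewrite lee_fin; apply: le_normr_Rintegral => //; exact: igS.
apply: hg => //; rewrite -lte_fin in sum_lt; apply: le_lt_trans sum_lt.
rewrite le_eqVlt; apply/orP; left; apply/eqP.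
rewrite /D measure_bigsetU_ord// -sumEFin; apply: eq_bigr => i _.
apply: etrans (lebesgue_measure_itv `]s i, t i[) _; rewrite /= lte_fin.
by have [_] := st i; case: ltgtP => // -> _; rewrite subrr.
Qed.

(** The fundamental theorem of calculus for absolutely continuous functions:
    F and the indefinite integral of g have the same derivative almost
    everywhere, and both are absolutely continuous. *)
Lemma abs_continuous_FTC (R : realType) (F g : R -> R) (T : R) : 0 < T ->
  abs_continuous 0 T F ->
  (@lebesgue_measure R).-integrable `]0, T[ (EFin \o g) ->
  {ae @lebesgue_measure R, forall t : R, 0 < t < T -> is_derive t 1 F (g t)} ->
  F T - F 0 = \int[lebesgue_measure]_(t in `]0, T[) g t.
Proof.
move=> T0 acF ig dF.
pose h := g \_ `]0, T[.
have ih : (@lebesgue_measure R).-integrable setT (EFin \o h).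
  by rewrite -restrict_EFin; apply/integrable_restrict => //=; rewrite setTI.
have ihS (A : set (measurableTypeR R)) : measurable A ->
    (@lebesgue_measure R).-integrable A (EFin \o h).
  by move=> mA; apply: integrableS ih.
pose I y := \int[lebesgue_measure]_(x in `]-oo, y]) h x.
have acI : abs_continuous 0 T I by exact: abs_continuous_integral.
have dI : {ae @lebesgue_measure R, forall t : R, 0 < t < T -> is_derive t 1 I (g t)}.
  have loch : locally_integrable setT h.
    exact: open_integrable_locally openT ih.
  have := @FTC1Ny R h (fun y => ihS _ (measurable_itv _)) loch.
  apply: ae_imp => /= t [dI It] tT; rewrite (_ : g t = h t); last first.
    by rewrite /h patchE mem_set//= in_itv.
  by rewrite -It derive1E; exact: derivableP.
have le12 (F1 F2 : R -> R) : abs_continuous 0 T F1 -> abs_continuous 0 T F2 ->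
    {ae @lebesgue_measure R, forall t : R, 0 < t < T -> is_derive t 1 F1 (g t)} ->
    {ae @lebesgue_measure R, forall t : R, 0 < t < T -> is_derive t 1 F2 (g t)} ->
    F1 T - F1 0 <= F2 T - F2 0.
  move=> ac1 ac2 d1 d2.
  suff : 1 * F1 T + (-1) * F2 T <= 1 * F1 0 + (-1) * F2 0 by lra.
  apply: (abs_continuous_nonincreasing (F := fun t => 1 * F1 t + (-1) * F2 t)).
  - exact: ltW.
  - exact: abs_continuousD.
  - apply: ae_imp2 d1 d2 => /= t h1 h2 tT; exists 0 => //.
    have {}h1 := h1 tT; have {}h2 := h2 tT.
    apply: (is_derive_eq (is_deriveD (is_deriveZ 1 h1) (is_deriveZ (-1) h2))).
    by rewrite /GRing.scale/=; lra.
have -> : F T - F 0 = I T - I 0 by apply/eqP; rewrite eq_le !le12.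
rewrite /I Rintegral_itvB//; [|exact: ihS|by rewrite bnd_simp ltW].
rewrite -Rintegral_itv_bndo_bndc; last exact: ihS.
by apply: eq_Rintegral => x xT; rewrite /h patchE xT.
Qed.

(** * Borel sets of R^n *)

(** An open set is the union of the rational boxes that it contains, and
    those are finite intersections of coordinate cylinders. *)
Lemma open_measurable_rV (R : realType) n (A : set 'rV[R]_n) :
  open A -> measurable A.
Proof.
move=> oA.
pose box (q : {ffun 'I_n -> rat * rat}) : set 'rV[R]_n :=
  \bigcap_(i in [set: 'I_n])
    ((fun v : 'rV[R]_n => v ord0 i) @^-1` `]ratr (q i).1, ratr (q i).2[).
pose F q := if `[< box q `<=` A >] then box q else set0.
have -> : A = \bigcup_q F q.
  apply/seteqP; split => [x Ax|x [q _]]; last first.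
    by rewrite /F; case: asboolP => [+ xq|_ []]; exact.
  have /nbhs_ballP[e /= e0 eA] : nbhs x A by rewrite nbhsE; exists A.
  have rats i : {q : rat * rat | x ord0 i - e < ratr q.1 < x ord0 i /\
      x ord0 i < ratr q.2 < x ord0 i + e}.
    apply: cid.
    have [q1 q1P] : exists q : rat, ratr q \in `]x ord0 i - e, x ord0 i[.
      by apply: rat_in_itvoo; rewrite ltrBlDr ltrDl.
    have [q2 q2P] : exists q : rat, ratr q \in `]x ord0 i, x ord0 i + e[.
      by apply: rat_in_itvoo; rewrite ltrDl.
    by exists (q1, q2); move: q1P q2P; rewrite !in_itv.
  exists [ffun i => sval (rats i)] => //.
  rewrite /F; case: asboolP => [_|].
    move=> i _ /=; rewrite ffunE in_itv/=.
    by have [/andP[_ ->] /andP[->]] := svalP (rats i).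
  case=> y hy; apply: eA; split => // i j; rewrite !ord1.
  have := hy j I; rewrite /= ffunE in_itv/=.
  have [/andP[h1 _] /andP[_ h2]] := svalP (rats j) => /andP[h3 h4].
  by rewrite /ball/= ltr_distlC; apply/andP; split; lra.
apply: countable_bigcupT_measurable => // q; rewrite /F.
case: asboolP => // _; apply: fin_bigcap_measurable => // i _.
by rewrite -[X in measurable X]setTI; apply: measurable_coord.
Qed.

Lemma continuous_measurable_rV (R : realType) n (g : 'rV[R]_n -> R) :
  continuous g -> measurable_fun setT g.
Proof.
move=> cg; apply: (measurability _ (RGenOInfty.measurableE R)).
move=> /= _ [_ [a ->]] <-; rewrite setTI; apply: open_measurable_rV.
by apply: open_comp => // x _; exact: cg.
Qed.

Lemma bounded_rVP (R : realType) n (A : set 'rV[R]_n) : bounded_set A ->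
  exists2 L : R, 0 < L & forall x, A x -> forall i, `|x ord0 i| < L.
Proof.
move=> [M [_ hM]]; exists (`|M| + 2) => [|x Ax i].
  by rewrite ltr_wpDl.
apply: (@le_lt_trans _ _ `|x|).
  rewrite [leRHS]mx_normrE.
  exact: (le_bigmax _ (fun ij => `|x ij.1 ij.2|) (ord0, i)).
apply: (@le_lt_trans _ _ (`|M| + 1)); last by rewrite ltrD2l ltr1n.
by apply: hM => //; have := ler_norm M; lra.
Qed.

Lemma lebesgue_rV_bounded (R : realType) n (A : set 'rV[R]_n) :
  measurable A -> bounded_set A -> (lebesgue_rV R n A < +oo)%E.
Proof.
move=> mA /bounded_rVP[L L0 hL].
have LL (i : 'I_n) : - L <= L by lra.
apply: (@le_lt_trans _ _
    (lebesgue_rV R n [set v | forall i, (- L <= v ord0 i <= L)%R])); last first.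
  by rewrite (lebesgue_rV_box LL) ltry.
apply: le_measure; rewrite ?inE//.
  rewrite [X in measurable X](_ : _ = \bigcap_(i in [set: 'I_n])
      ((fun v : 'rV[R]_n => v ord0 i) @^-1` `[- L, L])); last first.
    by apply/seteqP; split => v /= hv i; have := hv i; rewrite /= in_itv//=;
      exact.
  apply: fin_bigcap_measurable => // i _; rewrite -[X in measurable X]setTI.
  exact: measurable_coord.
by move=> x /hL /= xL i; rewrite -ler_norml ltW.
Qed.

(** * Poincare's inequality in L^3 *)

(** Jensen's inequality for the cube, obtained by integrating the tangent
    line inequality at the mean value of h. *)
Lemma jensen_cube (R : realType) (a b : R) (h : R -> R) : a < b ->
  continuous h -> (forall x, 0 <= h x) ->
  (\int[lebesgue_measure]_(x in `[a, b]) h x) ^+ 3 <=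
  (b - a) ^+ 2 * \int[lebesgue_measure]_(x in `[a, b]) h x ^+ 3.
Proof.
move=> ab ch h0.
have ic (k : R -> R) : continuous k ->
    (@lebesgue_measure R).-integrable `[a, b] (EFin \o k).
  move=> ck; apply: continuous_compact_integrable; first exact: segment_compact.
  exact: continuous_subspaceT.
set J := \int[lebesgue_measure]_(x in `[a, b]) h x.
set l := b - a; have l0 : 0 < l by rewrite /l subr_gt0.
have cst k : \int[lebesgue_measure]_(x in `[a, b]) (fun=> k) x = k * l.
  rewrite Rintegral_cst//; congr (_ * _).
  by rewrite [X in fine X](lebesgue_measure_itv `[a, b])/= lte_fin ab -EFinB.
pose m := J / l.
have J0 : 0 <= J by exact: Rintegral_ge0.
have m0 : 0 <= m by rewrite divr_ge0// ltW.
have tangent y : 0 <= y -> 3 * m ^+ 2 * y + (- 2 * m ^+ 3) <= y ^+ 3.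
  move=> y0; rewrite -subr_ge0.
  rewrite (_ : _ - _ = (y - m) ^+ 2 * (y + 2 * m)); last by ring.
  by rewrite mulr_ge0 ?sqr_ge0//; lra.
have c3 : continuous (fun x => h x ^+ 3).
  by move=> x; apply: (@continuous_comp _ _ _ h (fun y => y ^+ 3));
    [exact: ch|exact: exprn_continuous].
have cl : continuous (fun x => 3 * m ^+ 2 * h x).
  by move=> x; apply: cvgM; [exact: cvg_cst|exact: ch].
have ccst (k : R) : continuous (fun _ : R => k) by move=> x; exact: cvg_cst.
have : 3 * m ^+ 2 * J + (- 2 * m ^+ 3) * l <=
    \int[lebesgue_measure]_(x in `[a, b]) h x ^+ 3.
  rewrite -cst -RintegralZl//; last exact: ic.
  rewrite -RintegralD//; [|exact: (ic _ cl)|exact: (ic _ (ccst _))].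
  apply: le_Rintegral => //; [|exact: (ic _ c3)|by move=> x _; exact: tangent].
  by apply: (ic (fun x => _ + _)) => x; apply: cvgD; [exact: cl|exact: ccst].
move=> /(ler_wpM2l (ltW (exprn_gt0 2 l0))); apply: le_trans.
rewrite (_ : J = m * l); last by rewrite /m divfK// gt_eqF.
by rewrite le_eqVlt; apply/orP; left; apply/eqP; ring.
Qed.

(** Since g vanishes at - L, it is the integral of h from - L; Jensen's
    inequality bounds |g|^3 by (2 L)^2 int |h|^3 pointwise, and integrating
    over [- L, L] gives the third factor 2 L. *)
Lemma poincare_cube_1d (R : realType) (L : R) (g h : R -> R) : 0 < L ->
  (forall x : R, is_derive x 1 g (h x)) -> continuous h ->
  (forall x, L <= `|x| -> g x = 0) ->
  (\int[lebesgue_measure]_x (`|g x| ^+ 3)%:E <=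
   ((2 * L) ^+ 3)%:E * \int[lebesgue_measure]_x (`|h x| ^+ 3)%:E)%E.
Proof.
move=> L0 dg ch g0.
have LL : - L < L by lra.
have cn : continuous (fun x => `|h x|).
  by move=> x; apply: cvg_norm; exact: ch.
have cn3 : continuous (fun x => `|h x| ^+ 3).
  by move=> x; apply: (@continuous_comp _ _ _ (fun x => `|h x|) (fun y => y ^+ 3));
    [exact: cn|exact: exprn_continuous].
have cg : continuous g.
  move=> x; apply: differentiable_continuous; apply/derivable1_diffP.
  by case: (dg x).
have cgn : continuous (fun x => `|g x|).
  by move=> x; apply: cvg_norm; exact: cg.
have ic a b (k : R -> R) : continuous k ->
    (@lebesgue_measure R).-integrable `[a, b] (EFin \o k).
  move=> ck; apply: continuous_compact_integrable; first exact: segment_compact.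
  exact: continuous_subspaceT.
set J := \int[lebesgue_measure]_(x in `[- L, L]) `|h x| ^+ 3.
have gJ y : `|g y| ^+ 3 <= (2 * L) ^+ 2 * J.
  have [yL|yL] := leP L `|y|.
    rewrite g0// normr0 expr0n/=; apply: mulr_ge0; first exact: sqr_ge0.
    by apply: Rintegral_ge0 => x _; exact: exprn_ge0.
  have [Ly yL'] : - L < y /\ y < L by move: yL; rewrite ltr_norml => /andP.
  have FTC : g y = \int[lebesgue_measure]_(x in `[- L, y]) h x.
    rewrite /Rintegral (@continuous_FTC2 _ h g)//.
    - by rewrite (g0 (- L)) ?sube0// normrN ger0_norm// ltW.
    - exact: continuous_subspaceT.
    - split; [by move=> x _; case: (dg x)| |].
        exact/cvg_at_right_filter/cg.
      exact/cvg_at_left_filter/cg.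
    - by move=> x _; rewrite derive1E; case: (dg x).
  have : `|g y| <= \int[lebesgue_measure]_(x in `[- L, L]) `|h x|.
    rewrite FTC; apply: le_trans (le_normr_Rintegral _ _) _ => //; first exact: ic.
    rewrite -lee_fin !fineK; try by apply: integrable_fin_num => //; exact: (ic _ _ _ cn).
    apply: ge0_subset_integral => //=.
    - by have /integrableP[] := ic (- L) L _ cn.
    - by apply: subset_itvl; rewrite bnd_simp ltW.
  move=> /(lerXn2r 3 _ _) H; apply: (le_trans (H _ _)).
  - by rewrite nnegrE.
  - by rewrite nnegrE; exact: Rintegral_ge0.
  apply: le_trans (jensen_cube LL cn _) _ => //.
  by rewrite (_ : L - - L = 2 * L)//; lra.
have -> : (\int[lebesgue_measure]_x (`|g x| ^+ 3)%:E =
    \int[lebesgue_measure]_(x in `[(- L)%R, L]) (`|g x| ^+ 3)%:E)%E.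
  rewrite [RHS]integral_mkcond; apply: eq_integral => x _; rewrite patchE.
  case: ifPn => // /negP xL; rewrite g0 ?normr0 ?expr0n//=.
  rewrite leNgt; apply/negP => xL'; apply: xL; rewrite inE/= in_itv/=.
  by rewrite -ler_norml ltW.
have cg3 : continuous (fun x => `|g x| ^+ 3).
  by move=> x; apply: (@continuous_comp _ _ _ (fun x => `|g x|) (fun y => y ^+ 3));
    [exact: cgn|exact: exprn_continuous].
apply: (@le_trans _ _ (\int[lebesgue_measure]_(x in `[(- L)%R, L]) ((2 * L) ^+ 2 * J)%:E)%E).
  apply: ge0_le_integral => //=.
  - by have /integrableP[] := ic (- L) L _ cg3.
  - by move=> x _; rewrite lee_fin.
rewrite integral_cst//= (lebesgue_measure_itv `[- L, L]) /= lte_fin LL -EFinB.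
rewrite (_ : L - - L = 2 * L); last by lra.
rewrite -EFinM -mulrA [J * _]mulrC mulrA -exprSr EFinM.
apply: lee_wpmul2l; first by rewrite lee_fin exprn_ge0// mulr_ge0// ltW.
rewrite fineK; last exact: (integrable_fin_num _ (ic _ _ _ cn3)).
apply: ge0_subset_integral => //=.
by apply/measurable_EFinP; exact: continuous_measurable_fun.
Qed.

Lemma continuous_cons_rV (R : realType) n (v : 'rV[R]_n) :
  continuous (fun s : R => cons_rV (s, v)).
Proof.
move=> s; apply/cvg_ballP => e e0; apply/nbhs_ballP; exists e => // s' ss'.
split => // i j; rewrite (ord1 i).
have [k ->|->] := unliftP ord0 j; last by rewrite !cons_rV0.
by rewrite !cons_rVS; exact: ballxx.
Qed.

Lemma cons_rV_shift (R : realType) n (s h : R) (v : 'rV[R]_n) :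
  cons_rV (h *: (1 : R) + s, v) = h *: delta_mx ord0 ord0 + cons_rV (s, v).
Proof.
rewrite [h *: (1 : R)]mulr1; apply/rowP => j.
rewrite [RHS]mxE [X in _ = X + _]mxE [X in _ = _ * X + _]mxE.
have [k ->|->] := unliftP ord0 j.
  by rewrite !cons_rVS [lift _ _ == _]eq_sym (negbTE (neq_lift _ _)) andbF mulr0 add0r.
by rewrite !cons_rV0 !eqxx mulr1.
Qed.

(** Only derivatives in the first coordinate are used, so Poincare's
    inequality is the one-dimensional one integrated over the other
    coordinates. *)
Lemma poincare_cube (R : realType) n (L : R) (phi : 'rV[R]_n.+1 -> R) :
  0 < L -> continuous phi -> continuous (partial ord0 phi) ->
  (forall x, derivable phi x (delta_mx ord0 ord0)) ->
  (forall x : 'rV[R]_n.+1, L <= `|x ord0 ord0| -> phi x = 0) ->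
  (\int[lebesgue_rV R n.+1]_x (`|phi x| ^+ 3)%:E <=
   ((2 * L) ^+ 3)%:E *
   \int[lebesgue_rV R n.+1]_x (`|partial ord0 phi x| ^+ 3)%:E)%E.
Proof.
move=> L0 cphi cdphi dphi phi0.
have slice (k : 'rV[R]_n.+1 -> R) : continuous k ->
    (\int[lebesgue_rV R n.+1]_x (`|k x| ^+ 3)%:E =
     \int[lebesgue_rV R n]_v \int[lebesgue_measure]_s
        (`|k (cons_rV (s, v))| ^+ 3)%:E)%E.
  move=> ck; have mk : measurable_fun setT (fun x => (`|k x| ^+ 3)%:E).
    apply/measurable_EFinP; apply: measurable_funX; apply: measurableT_comp => //.
    exact: continuous_measurable_rV.
  have mc : measurable_fun [set: measurableTypeR R * 'rV[R]_n] (@cons_rV R n).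
    exact: measurable_cons_rV.
  have k0 : {in [set: 'rV[R]_n.+1], forall y, (0%R <= (`|k y| ^+ 3)%:E)%E}.
    by move=> x _; rewrite lee_fin exprn_ge0.
  have := ge0_integral_pushforward mc
    ((@lebesgue_measure R) \x (lebesgue_rV R n))%E measurableT mk k0.
  move=> /= ->; rewrite preimage_setT.
  rewrite (@fubini_tonelli2 _ _ (measurableTypeR R) 'rV[R]_n)//=.
  - exact: measurableT_comp mk (@measurable_cons_rV R n).
have mslice (k : 'rV[R]_n.+1 -> R) : continuous k ->
    measurable_fun [set: 'rV[R]_n] (fun v =>
      \int[lebesgue_measure]_s (`|k (cons_rV (s, v))| ^+ 3)%:E)%E.
  move=> ck; apply: (@measurable_fun_fubini_tonelli_G _ _ (measurableTypeR R)
    'rV[R]_n R lebesgue_measure (fun z => (`|k (cons_rV z)| ^+ 3)%:E)).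
    apply/measurable_EFinP; apply: measurable_funX; apply: measurableT_comp => //.
    apply: measurableT_comp (@measurable_cons_rV R n).
    exact: continuous_measurable_rV.
  by move=> x; rewrite lee_fin exprn_ge0.
rewrite (slice _ cphi) (slice _ cdphi) -ge0_integralZl//.
- apply: ge0_le_integral => //=.
  + by move=> v _; apply: integral_ge0 => s _; rewrite lee_fin exprn_ge0.
  + exact: mslice.
  + by apply: measurable_funeM; exact: mslice.
  move=> v _; apply: (@poincare_cube_1d _ L (fun s => phi (cons_rV (s, v)))
    (fun s => partial ord0 phi (cons_rV (s, v)))) => //.
  + move=> s.
    have E : (fun h : R => h^-1 *: (((fun s => phi (cons_rV (s, v))) \o shift s)
        (h *: 1) - phi (cons_rV (s, v)))) =
      (fun h : R => h^-1 *: ((phi \o shift (cons_rV (s, v)))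
        (h *: delta_mx ord0 ord0) - phi (cons_rV (s, v)))).
      by apply/funext => h /=; rewrite cons_rV_shift.
    have dx := dphi (cons_rV (s, v)).
    split; first by rewrite /derivable E.
    by rewrite /derive E.
  + move=> s; apply: (@continuous_comp _ _ _ (fun s => cons_rV (s, v))).
      exact: continuous_cons_rV.
    exact: cdphi.
  + by move=> s Ls; apply: phi0; rewrite cons_rV0.
- exact: mslice.
- by move=> v _; apply: integral_ge0 => s _; rewrite lee_fin exprn_ge0.
- by rewrite lee_fin exprn_ge0// mulr_ge0// ltW.
Qed.

(** * Lebesgue and Frobenius norms *)

Lemma Lq_normE (R : realType) n q (Omega : set 'rV[R]_n) (g : 'rV[R]_n -> R) :
  (0 < q)%N ->
  (Lq_norm q Omega g `^ q%:R =
   \int[lebesgue_rV R n]_(x in Omega) (`|g x| ^+ q)%:E)%E.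
Proof.
move=> q0; rewrite /Lq_norm poweR_Lnorm ?pnatr_eq0 -?lt0n//.
rewrite [RHS]integral_mkcond; apply: eq_integral => x _.
rewrite /= !patchE; case: ifPn => _.
  by rewrite /= powR_mulrn.
by rewrite /= normr0 powR0// pnatr_eq0 -lt0n.
Qed.

Lemma Lq_norm_le (R : realType) n q (Omega : set 'rV[R]_n) (g : 'rV[R]_n -> R)
    (M : R) : (0 < q)%N -> 0 <= M ->
  (Lq_norm q Omega g <= M%:E)%E =
  (\int[lebesgue_rV R n]_(x in Omega) (`|g x| ^+ q)%:E <= (M ^+ q)%:E)%E.
Proof.
move=> q0 M0; rewrite -Lq_normE//.
have N0 : (0 <= Lq_norm q Omega g)%E by exact: Lnorm_ge0.
have qR : (0 : R) < q%:R by rewrite ltr0n.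
have -> : ((M ^+ q)%:E = M%:E `^ q%:R)%E by rewrite poweR_EFin powR_mulrn.
case: (Lq_norm q Omega g) N0 => [r||] //.
  rewrite lee_fin => r0; rewrite !poweR_EFin !lee_fin !powR_mulrn//.
  by rewrite ler_pXn2r.
by rewrite poweRyr ?gt_eqF// !leye_eq.
Qed.

Section frobenius.
Context (R : realType) (m n : nat).
Implicit Types A B : 'M[R]_(m, n).

Lemma frob_ge0 A : 0 <= frob A A.
Proof. by apply: sumr_ge0 => i _; apply: sumr_ge0 => j _; rewrite -expr2 sqr_ge0. Qed.

Lemma fnorm_ge0 A : 0 <= fnorm A.
Proof. exact: sqrtr_ge0. Qed.

Lemma fnorm_sqr A : fnorm A ^+ 2 = frob A A.
Proof. by rewrite sqr_sqrtr// frob_ge0. Qed.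

Lemma frobZl (a : R) A B : frob (a *: A) B = a * frob A B.
Proof.
rewrite /frob mulr_sumr; apply: eq_bigr => i _; rewrite mulr_sumr.
by apply: eq_bigr => j _; rewrite mxE mulrA.
Qed.

Lemma frobZr (a : R) A B : frob A (a *: B) = a * frob A B.
Proof.
rewrite /frob mulr_sumr; apply: eq_bigr => i _; rewrite mulr_sumr.
by apply: eq_bigr => j _; rewrite mxE mulrCA.
Qed.

Lemma frobDl A A' B : frob (A + A') B = frob A B + frob A' B.
Proof.
rewrite /frob -big_split; apply: eq_bigr => i _; rewrite -big_split.
by apply: eq_bigr => j _; rewrite /= mxE mulrDl.
Qed.

Lemma frobNl A B : frob (- A) B = - frob A B.
Proof. by rewrite -scaleN1r frobZl mulN1r. Qed.

Lemma fnormZ (a : R) A : fnorm (a *: A) = `|a| * fnorm A.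
Proof. by rewrite /fnorm frobZl frobZr mulrA -expr2 sqrtrM ?sqr_ge0// sqrtr_sqr. Qed.

(** Entry by entry, the difference of the two sides is a positive multiple of
    the square of a - e b or a + e b. *)
Lemma frob_young (e : R) A B : 0 < e ->
  `|frob A B| <= (2 * e)^-1 * fnorm A ^+ 2 + e / 2 * fnorm B ^+ 2.
Proof.
move=> e0; rewrite !fnorm_sqr /frob !mulr_sumr -big_split/=.
apply: le_trans (ler_norm_sum _ _ _) _; apply: ler_sum => i _.
rewrite !mulr_sumr -big_split/=.
apply: le_trans (ler_norm_sum _ _ _) _; apply: ler_sum => j _.
set a := A i j; set b := B i j.
have d0 : 0 < (2 * e)^-1 by rewrite invr_gt0 mulr_gt0.
have key s : s ^+ 2 = 1 ->
    s * (a * b) <= (2 * e)^-1 * (a * a) + e / 2 * (b * b).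
  move=> s2; rewrite -subr_ge0.
  rewrite (_ : _ - _ = (2 * e)^-1 * (a - s * (e * b)) ^+ 2).
    by rewrite mulr_ge0 ?sqr_ge0 ?ltW.
  rewrite sqrrB exprMn s2.
  by field; rewrite gt_eqF.
have h1 := key 1 (expr1n _ _); have h2 := key (-1) (etrans (sqrrN 1) (expr1n _ _)).
by rewrite ler_norml; apply/andP; split; lra.
Qed.

Lemma coord_le_fnorm A i j : `|A i j| <= fnorm A.
Proof.
rewrite -(@ler_pXn2r _ 2)// ?nnegrE ?fnorm_ge0// fnorm_sqr real_normK ?num_real//.
rewrite /frob (bigD1 i)//= (bigD1 j)//= -!expr2 -addrA lerDl addr_ge0//.
  by apply: sumr_ge0 => k _; rewrite -expr2 sqr_ge0.
by apply: sumr_ge0 => k _; apply: sumr_ge0 => l _; rewrite -expr2 sqr_ge0.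
Qed.

End frobenius.

(** The norm is at most n times the largest coordinate, whose cube is one of
    the terms of the sum. *)
Lemma fnorm_cube_le (R : realType) n (u : 'rV[R]_n) :
  fnorm u ^+ 3 <= n%:R ^+ 3 * \sum_i `|u ord0 i| ^+ 3.
Proof.
case: n u => [|n] u.
  by rewrite /fnorm /frob big_ord1 big_ord0 sqrtr0 expr0n/= big_ord0 mulr0.
pose i0 := [arg max_(i > (ord0 : 'I_n.+1)) `|u ord0 i|]%O.
have hi0 i : `|u ord0 i| <= `|u ord0 i0|.
  by rewrite /i0; case: arg_maxP => //= j _; exact.
set M := `|u ord0 i0|; have M0 : 0 <= M by exact: normr_ge0.
have uM : fnorm u <= n.+1%:R * M.
  rewrite -(@ler_pXn2r _ 2)// ?nnegrE ?fnorm_ge0 ?mulr_ge0//.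
  rewrite fnorm_sqr /frob big_ord1 exprMn.
  apply: (@le_trans _ _ (\sum_(j < n.+1) M ^+ 2)).
    apply: ler_sum => j _; rewrite -expr2 -[leLHS]real_normK ?num_real//.
    by rewrite ler_pXn2r// ?nnegrE.
  rewrite sumr_const card_ord -[leLHS]mulr_natl ler_wpM2r ?sqr_ge0//.
  by rewrite -natrX ler_nat expnS expn1 leq_pmulr.
apply: (@le_trans _ _ ((n.+1%:R * M) ^+ 3)).
  by rewrite ler_pXn2r// ?nnegrE ?fnorm_ge0 ?mulr_ge0.
rewrite exprMn ler_wpM2l ?exprn_ge0//.
rewrite (bigD1 i0)//= lerDl; apply: sumr_ge0 => i _; exact: exprn_ge0.
Qed.

Section frobenius_measurable.
Context d (T : measurableType d) (R : realType) (m n : nat) (D : set T).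
Implicit Types u v : T -> 'M[R]_(m, n).

Lemma measurable_frob u v :
  (forall i j, measurable_fun D (fun x => u x i j)) ->
  (forall i j, measurable_fun D (fun x => v x i j)) ->
  measurable_fun D (fun x => frob (u x) (v x)).
Proof.
move=> mu mv; apply: measurable_sum => i; apply: measurable_sum => j.
exact: measurable_funM.
Qed.

Lemma measurable_fnorm u :
  (forall i j, measurable_fun D (fun x => u x i j)) ->
  measurable_fun D (fun x => fnorm (u x)).
Proof.
move=> mu; apply: (measurableT_comp (f := @Num.sqrt R)).
  by apply: continuous_measurable_fun; exact: sqrt_continuous.
exact: measurable_frob.
Qed.

(** The sigma-algebra of matrices is generated by the coordinates. *)
Lemma measurable_mxP u : measurable D -> measurable_fun D u <->
  (forall i j, measurable_fun D (fun x => u x i j)).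
Proof.
move=> mD; split=> [mu i j|mu].
  by apply: (measurableT_comp (f := fun M : 'M[R]_(m, n) => M i j)) mu;
    exact: measurable_coord.
apply: (@measurability _ _ _ _ _ u (@matrix_cylinders R m n)) => //.
by move=> _ [_ [i [j [B [mB ->]]]] <-]; exact: mu.
Qed.

End frobenius_measurable.

Lemma Lq_norm_fnorm_le (R : realType) n m1 m2 q (Omega : set 'rV[R]_n)
    (u : 'rV[R]_n -> 'M[R]_(m1, m2)) (M : R) : (0 < q)%N -> 0 <= M ->
  (Lq_norm q Omega (@fnorm R m1 m2 \o u) <= M%:E)%E =
  (\int[lebesgue_rV R n]_(x in Omega) (fnorm (u x) ^+ q)%:E <= (M ^+ q)%:E)%E.
Proof.
move=> q0 M0; rewrite Lq_norm_le//; congr (_ <= _)%E.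
by apply: eq_integral => x _; rewrite /= ger0_norm ?fnorm_ge0.
Qed.

Lemma cube_normD (R : realType) (a b : R) :
  `|a + b| ^+ 3 <= 4 * (`|a| ^+ 3 + `|b| ^+ 3).
Proof.
have a0 := normr_ge0 a; have b0 := normr_ge0 b.
apply: (@le_trans _ _ ((`|a| + `|b|) ^+ 3)).
  by rewrite ler_pXn2r ?nnegrE ?addr_ge0// ler_normD.
rewrite -subr_ge0 (_ : _ - _ = 3 * (`|a| + `|b|) * (`|a| - `|b|) ^+ 2); last by ring.
by rewrite mulr_ge0 ?sqr_ge0// mulr_ge0// addr_ge0.
Qed.

Lemma integral_cube_normD d (T : measurableType d) (R : realType)
    (mu : {measure set T -> \bar R}) (D : set T) (f g h : T -> R) :
  measurable D -> measurable_fun D f -> measurable_fun D g ->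
  (forall x, D x -> h x = f x + g x) ->
  (\int[mu]_(x in D) (`|h x| ^+ 3)%:E <=
   4%:E * (\int[mu]_(x in D) (`|f x| ^+ 3)%:E +
           \int[mu]_(x in D) (`|g x| ^+ 3)%:E))%E.
Proof.
move=> mD mf mg hfg.
have mc (k : T -> R) : measurable_fun D k ->
    measurable_fun D (fun x => (`|k x| ^+ 3)%:E).
  move=> mk; apply/measurable_EFinP; apply: measurable_funX.
  exact: measurableT_comp.
have k0 (k : T -> R) x : D x -> (0 <= (`|k x| ^+ 3)%:E)%E.
  by rewrite lee_fin exprn_ge0.
have mcD : measurable_fun D (fun x => (`|f x| ^+ 3)%:E + (`|g x| ^+ 3)%:E)%E.
  by apply: emeasurable_funD; exact: mc.
have mh : measurable_fun D (fun x => (`|h x| ^+ 3)%:E).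
  apply: (eq_measurable_fun (fun x => (`|f x + g x| ^+ 3)%:E)).
    by move=> x; rewrite inE => Dx; rewrite hfg.
  by apply: mc; exact: measurable_funD.
rewrite -ge0_integralD//; try by [exact: mc|move=> x Dx; exact: k0].
rewrite -ge0_integralZl//; try by move=> x Dx; rewrite adde_ge0// k0.
apply: ge0_le_integral => //; first exact: measurable_funeM.
by move=> x Dx; rewrite hfg// -EFinD -EFinM lee_fin; exact: cube_normD.
Qed.

(** * Poincare's inequality for functions of zero trace *)

(** The complement of the support of phi is an open set on which phi is
    constant. *)
Lemma partial_support (R : realType) n (Omega : set 'rV[R]_n) j
    (phi : 'rV[R]_n -> R) x :
  test_fun Omega phi -> ~ Omega x -> partial j phi x = 0.
Proof.
move=> [_ [K [cK KO phiK]]] nOx.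
have oK : open (~` K).
  by apply: closed_openC; apply: compact_closed => //; exact: norm_hausdorff.
have nKx : (~` K) x by move=> /KO.
have phi0 : \forall y \near x, phi y = 0.
  have : \forall y \near x, (~` K) y by exact: open_nbhs_nbhs.
  apply: filterS => y nKy; apply/eqP; apply: contrapT => /negP /phiK; exact: nKy.
rewrite /partial; have := derive_cst (0 : R) x (delta_mx ord0 j).
by move=> <-; apply: near_eq_derive.
Qed.

(** A single test function is enough, within 1 of the i-th component of u in
    L^3 together with the first derivatives: no limit is taken, and the error
    goes into the additive constant. *)
Lemma zero_trace_cube_le (R : realType) n (L : R) (Omega : set 'rV[R]_n.+1)
    (u : 'rV[R]_n.+1 -> 'rV[R]_n.+1) (G : 'rV[R]_n.+1 -> 'M[R]_n.+1) i :
  0 < L -> measurable Omega ->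
  (forall x, Omega x -> `|x ord0 ord0| < L) ->
  measurable_fun Omega (fun x => u x ord0 i) ->
  measurable_fun Omega (fun x => G x i ord0) ->
  zero_trace 3 Omega u G ->
  (\int[lebesgue_rV R n.+1]_(x in Omega) (`|u x ord0 i| ^+ 3)%:E <=
   (4 + 4 * (4 * (2 * L) ^+ 3))%:E + (4 * (4 * (2 * L) ^+ 3))%:E *
     \int[lebesgue_rV R n.+1]_(x in Omega) (`|G x i ord0| ^+ 3)%:E)%E.
Proof.
move=> L0 mO OL mu mG zt; set c := 4 * (2 * L) ^+ 3.
have [phi [tphi cvu cvG]] := zt i.
have c0 : 0 <= c by rewrite /c mulr_ge0// exprn_ge0// mulr_ge0// ltW.
have small (v : nat -> 'rV[R]_n.+1 -> R) : Lq_norm 3 Omega (v k) @[k --> \oo] --> 0%E ->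
    \forall k \near \oo, (\int[lebesgue_rV R n.+1]_(x in Omega)
      (`|v k x| ^+ 3)%:E <= 1)%E.
  move=> cv; have : \forall k \near \oo, (Lq_norm 3 Omega (v k) < 1)%E.
    by apply: (cv [set z | z < 1]%E); exact: (@nbhs_open_ereal_lt R 0 (fun=> 1)).
  by apply: filterS => k /ltW; rewrite (@Lq_norm_le _ _ 3 _ _ 1)// expr1n.
have [k [hu hG]] : exists k,
    (\int[lebesgue_rV R n.+1]_(x in Omega)
       (`|phi k x - u x ord0 i| ^+ 3)%:E <= 1)%E /\
    (\int[lebesgue_rV R n.+1]_(x in Omega)
       (`|partial ord0 (phi k) x - G x i ord0| ^+ 3)%:E <= 1)%E.
  have h1 := small _ cvu; have h2 := small _ (cvG ord0).
  have [N _ hN] := filterI h1 h2.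
  by exists N; exact: (hN N (leqnn N)).
have [sphi [K [cK KO phiK]]] := tphi k.
have [cphi dphi] := sphi [::]; have [cdphi _] := sphi [:: ord0].
have phi0 x : ~ Omega x -> phi k x = 0.
  by move=> nO; apply/eqP; apply: contrapT => /negP /phiK /KO.
have mphi : measurable_fun Omega (phi k).
  by apply: measurable_funTS; exact: continuous_measurable_rV.
have mdphi : measurable_fun Omega (partial ord0 (phi k)).
  by apply: measurable_funTS; exact: continuous_measurable_rV.
have onO (v : 'rV[R]_n.+1 -> R) : (forall x, ~ Omega x -> v x = 0) ->
    (\int[lebesgue_rV R n.+1]_x (`|v x| ^+ 3)%:E =
     \int[lebesgue_rV R n.+1]_(x in Omega) (`|v x| ^+ 3)%:E)%E.
  move=> v0; rewrite [RHS]integral_mkcond; apply: eq_integral => x _.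
  rewrite patchE; case: ifPn => // /negP nOx; rewrite v0 ?normr0 ?expr0n//.
  by move=> Ox; apply: nOx; rewrite inE.
have poinc : (\int[lebesgue_rV R n.+1]_(x in Omega) (`|phi k x| ^+ 3)%:E <=
    ((2 * L) ^+ 3)%:E * \int[lebesgue_rV R n.+1]_(x in Omega)
      (`|partial ord0 (phi k) x| ^+ 3)%:E)%E.
  rewrite -(onO _ phi0) -(onO (partial ord0 (phi k))); last first.
    by move=> x; exact: partial_support.
  apply: poincare_cube => //.
  by move=> x Lx; apply: phi0 => /OL; rewrite ltNge Lx.
have leu : (\int[lebesgue_rV R n.+1]_(x in Omega) (`|u x ord0 i| ^+ 3)%:E <=
    4%:E * (1 + \int[lebesgue_rV R n.+1]_(x in Omega) (`|phi k x| ^+ 3)%:E))%E.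
  apply: le_trans (integral_cube_normD _ (f := fun x => - (phi k x - u x ord0 i))
    (g := phi k) mO _ _ _) _ => //.
  - by apply: measurable_funN; exact: measurable_funB.
  - by move=> x _; ring.
  - by apply: lee_wpmul2l => //; apply: leeD => //; under eq_integral do rewrite normrN.
have leG : (\int[lebesgue_rV R n.+1]_(x in Omega)
      (`|partial ord0 (phi k) x| ^+ 3)%:E <=
    4%:E * (1 + \int[lebesgue_rV R n.+1]_(x in Omega) (`|G x i ord0| ^+ 3)%:E))%E.
  apply: le_trans (integral_cube_normD _
    (f := fun x => partial ord0 (phi k) x - G x i ord0)
    (g := fun x => G x i ord0) mO _ _ _) _ => //.
  - exact: measurable_funB.
  - by move=> x _; ring.
  - by apply: lee_wpmul2l => //; apply: leeD.
apply: (le_trans leu).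
set X := (\int[_]_(x in Omega) (`|G x i ord0| ^+ 3)%:E)%E in leG *.
have X0 : (0 <= X)%E by apply: integral_ge0 => x _; rewrite lee_fin exprn_ge0.
apply: (@le_trans _ _ (4%:E * (1 + ((2 * L) ^+ 3)%:E * (4%:E * (1 + X))))%E).
  apply: lee_wpmul2l => //; apply: leeD => //; apply: (le_trans poinc).
  by apply: lee_wpmul2l => //; rewrite lee_fin exprn_ge0// mulr_ge0// ltW.
rewrite muleA -EFinM [_ ^+ 3 * 4]mulrC -/c.
have cE0 : (0 <= c%:E)%E by rewrite lee_fin.
rewrite (ge0_muleDr c%:E)// ge0_muleDr// ?adde_ge0 ?mule_ge0//.
rewrite ge0_muleDr ?mule_ge0// !mule1 muleA -!EFinM addeA -EFinD.
exact: lexx.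
Qed.

(** The additive constant A comes from the approximation by one test function;
    an affine bound is all that the energy estimate requires. *)
Lemma poincare_zero_trace (R : realType) n (Omega : set 'rV[R]_n.+1) :
  measurable Omega -> bounded_set Omega ->
  exists A B : R, [/\ 0 <= A, 0 < B &
    forall (u : 'rV[R]_n.+1 -> 'rV[R]_n.+1) (G : 'rV[R]_n.+1 -> 'M[R]_n.+1),
      measurable_fun Omega u -> measurable_fun Omega G ->
      zero_trace 3 Omega u G ->
      (\int[lebesgue_rV R n.+1]_(x in Omega) (fnorm (u x) ^+ 3)%:E <=
       A%:E + B%:E *
         \int[lebesgue_rV R n.+1]_(x in Omega) (fnorm (G x) ^+ 3)%:E)%E].
Proof.
move=> mO /bounded_rVP[L L0 hL].
pose c := 4 * (4 * (2 * L) ^+ 3).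
have c0 : 0 < c by rewrite /c !mulr_gt0// exprn_gt0// mulr_gt0.
pose N : R := n.+1%:R; have N0 : 0 < N by rewrite ltr0n.
exists (N ^+ 3 * (N * (4 + c))), (N ^+ 3 * (N * c)); split.
- by rewrite !mulr_ge0 ?exprn_ge0 ?addr_ge0// ltW.
- by rewrite !mulr_gt0 ?exprn_gt0.
move=> u G /(measurable_mxP _ mO) mu /(measurable_mxP _ mO) mG zt.
set X := (\int[_]_(x in Omega) (fnorm (G x) ^+ 3)%:E)%E.
have X0 : (0 <= X)%E.
  by apply: integral_ge0 => x _; rewrite lee_fin exprn_ge0// fnorm_ge0.
have mc i : measurable_fun Omega (fun x => (`|u x ord0 i| ^+ 3)%:E).
  by apply/measurable_EFinP; apply: measurable_funX; exact: measurableT_comp.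
have mf3 m1 m2 (v : 'rV[R]_n.+1 -> 'M[R]_(m1, m2)) :
    (forall i j, measurable_fun Omega (fun x => v x i j)) ->
    measurable_fun Omega (fun x => (fnorm (v x) ^+ 3)%:E).
  by move=> mv; apply/measurable_EFinP; apply: measurable_funX; exact: measurable_fnorm.
have ui i : (\int[lebesgue_rV R n.+1]_(x in Omega) (`|u x ord0 i| ^+ 3)%:E <=
    (4 + c)%:E + c%:E * X)%E.
  apply: le_trans (zero_trace_cube_le L0 mO (fun x Ox => hL x Ox ord0)
    (mu _ i) (mG i ord0) zt) _; rewrite -/c.
  rewrite leeD2l// lee_wpmul2l ?lee_fin ?(ltW c0)//.
  apply: ge0_le_integral => //.
  - by apply/measurable_EFinP; apply: measurable_funX; exact: measurableT_comp.
  - exact: mf3.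
  - move=> x _; rewrite lee_fin ler_pXn2r// ?nnegrE ?fnorm_ge0//.
    exact: coord_le_fnorm.
have msum : measurable_fun Omega (fun x => \sum_(i < n.+1) (`|u x ord0 i| ^+ 3)%:E)%E.
  exact: emeasurable_sum.
have N3 : (0 <= (N ^+ 3)%:E)%E by rewrite lee_fin exprn_ge0// ltW.
apply: (@le_trans _ _ (\int[lebesgue_rV R n.+1]_(x in Omega)
    ((N ^+ 3)%:E * \sum_(i < n.+1) (`|u x ord0 i| ^+ 3)%:E))%E).
  apply: ge0_le_integral => //.
  - by move=> x _; rewrite lee_fin exprn_ge0// fnorm_ge0.
  - exact: mf3.
  - exact: measurable_funeM.
  - by move=> x _; rewrite sumEFin -EFinM lee_fin; exact: fnorm_cube_le.
rewrite ge0_integralZl//; last first.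
  by move=> x _; apply: sume_ge0 => i _; rewrite lee_fin exprn_ge0.
rewrite ge0_integral_sum//.
apply: (@le_trans _ _ ((N ^+ 3)%:E * \sum_(i < n.+1) ((4 + c)%:E + c%:E * X))%E).
  by apply: lee_wpmul2l => //; apply: lee_sum => i _; exact: ui.
have cX0 : (0 <= c%:E * X)%E by rewrite mule_ge0// lee_fin ltW.
have c40 : (0 <= (4 + c)%:E)%E by rewrite lee_fin addr_ge0// ltW.
have -> : (\sum_(i < n.+1) ((4 + c)%:E + c%:E * X) =
    N%:E * ((4 + c)%:E + c%:E * X))%E.
  transitivity (\sum_(i < n.+1) 1%:E * ((4 + c)%:E + c%:E * X))%E.
    by apply: eq_bigr => i _; rewrite mul1e.
  by rewrite -ge0_sume_distrl// sumEFin sumr_const card_ord.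
rewrite muleA -EFinM ge0_muleDr// muleA -!EFinM !mulrA.
exact: lexx.
Qed.

(** * Quadratic integrals bounded by cubic ones *)

Lemma sqr_le_cube (R : realType) (x : R) : 0 <= x -> x ^+ 2 <= 1 + x ^+ 3.
Proof.
move=> x0; have [x1|x1] := leP x 1.
  by rewrite ler_wpDr ?exprn_ge0// exprn_ile1.
by rewrite ler_wpDl// [leRHS]exprS ler_peMl ?exprn_ge0// ltW.
Qed.

Lemma mul_sqr_le_cubes (R : realType) (x y : R) : 0 <= x -> 0 <= y ->
  x * y ^+ 2 <= x ^+ 3 + y ^+ 3.
Proof.
move=> x0 y0; have [xy|yx] := leP x y.
  by rewrite ler_wpDl ?exprn_ge0// [leRHS]exprS ler_wpM2r// exprn_ge0.
rewrite ler_wpDr ?exprn_ge0// [leRHS]exprS ler_wpM2l//.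
by rewrite ler_pXn2r ?nnegrE// ltW.
Qed.

Lemma integral_sqr_le d (T : measurableType d) (R : realType)
    (mu : {measure set T -> \bar R}) (D : set T) (g : T -> R) :
  measurable D -> measurable_fun D g -> (forall x, 0 <= g x) ->
  (\int[mu]_(x in D) (g x ^+ 2)%:E <=
   mu D + \int[mu]_(x in D) (g x ^+ 3)%:E)%E.
Proof.
move=> mD mg g0.
have mX k : measurable_fun D (fun x => (g x ^+ k)%:E).
  by apply/measurable_EFinP; exact: measurable_funX.
rewrite -[mu D]mul1e -integral_cst// -ge0_integralD//; last first.
  by move=> x _; rewrite lee_fin exprn_ge0.
apply: ge0_le_integral => //.
- by move=> x _; rewrite lee_fin exprn_ge0.
- by apply: emeasurable_funD => //; exact: measurable_cst.
- by move=> x _; rewrite -EFinD lee_fin; exact: sqr_le_cube.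
Qed.

(** * Time averages of the energy balance *)

Lemma ae_bounded_integral (R : realType) (T B : R) (g : R -> R) : 0 < T -> 0 <= B ->
  measurable_fun `]0, T[ g ->
  {ae @lebesgue_measure R, forall t : R, 0 < t < T -> `|g t| <= B} ->
  (@lebesgue_measure R).-integrable `]0, T[ (EFin \o g) /\
  `|\int[lebesgue_measure]_(t in `]0, T[) g t| <= B * T.
Proof.
move=> T0 B0 mg gB.
have mI : measurable (`]0, T[%classic : set (measurableTypeR R)) by exact: measurable_itv.
have mn : measurable_fun (`]0, T[%classic : set (measurableTypeR R)) (fun t => `|g t|%:E).
  by apply/measurable_EFinP; exact: measurableT_comp.
have bnd : (\int[@lebesgue_measure R]_(t in `]0%R, T[) `|g t|%:E <= (B * T)%:E)%E.
  apply: (@le_trans _ _ (\int[@lebesgue_measure R]_(t in `]0%R, T[) `|B|%:E)%E).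
    apply: ae_ge0_le_integral => //.
    apply: ae_imp gB => /= t tB; rewrite in_itv/= => t0T.
    by rewrite lee_fin (le_trans (tB t0T))// ler_norm.
  rewrite integral_cst// [X in (_ * X)%E](lebesgue_measure_itv `]0, T[)/= lte_fin T0.
  rewrite sube0 -EFinM lee_fin.
  by rewrite ger0_norm.
have ig : (@lebesgue_measure R).-integrable `]0, T[ (EFin \o g).
  apply/integrableP; split; first exact/measurable_EFinP.
  by apply: le_lt_trans bnd _; rewrite ltry.
split=> //; apply: le_trans (le_normr_Rintegral mI ig) _.
rewrite -lee_fin fineK//; apply: integrable_fin_num => //.
exact: (integrable_abse ig).
Qed.

(** The part of the argument that only sees the energy E, the dissipation D and
    the power P as functions of time. The bound C on the averages of D has to
    hold down to T = 0, where (E 0) / T is unbounded: there the local bound on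
    D is used. *)
Lemma dissipation_average (R : realType) (E D P : R -> R) (M B : R) :
  loc_abs_continuous E -> (forall t, 0 <= t -> 0 <= E t <= M) ->
  (forall T, 0 < T -> measurable_fun (`]0, T[ : set R) D) ->
  measurable_fun (`]0, +oo[ : set R) P ->
  0 <= B ->
  {ae @lebesgue_measure R, forall t : R, 0 < t ->
     [/\ is_derive t 1 E (P t - D t), 0 <= D t & `|P t| <= B]} ->
  (forall T, 0 < T -> exists b, {ae @lebesgue_measure R, forall t : R,
     0 < t < T -> D t <= b}) ->
  [/\ forall T, 0 < T -> (@lebesgue_measure R).-integrable `]0, T[ (EFin \o D),
      forall T, 0 < T -> E T - E 0 =
        \int[lebesgue_measure]_(t in `]0, T[) P t -
        \int[lebesgue_measure]_(t in `]0, T[) D t,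
      forall T, 0 < T -> `|T^-1 * \int[lebesgue_measure]_(t in `]0, T[) P t| <= B &
      exists C, forall T, 0 < T ->
        T^-1 * \int[lebesgue_measure]_(t in `]0, T[) D t <= C].
Proof.
move=> acE E0M mD mP B0 aeE bD.
have sub T : `]0, T[%classic `<=` (`]0, +oo[%classic : set R).
  by apply: subset_itvl; rewrite bnd_simp.
have mIT (g : R -> R) T : measurable_fun (`]0, +oo[ : set R) g ->
    measurable_fun (`]0, T[ : set R) g.
  by move=> mg; apply: measurable_funS (sub T) mg; exact: measurable_itv.
have PT T : 0 < T -> (@lebesgue_measure R).-integrable `]0, T[ (EFin \o P) /\
    `|\int[lebesgue_measure]_(t in `]0, T[) P t| <= B * T.
  move=> T0; apply: ae_bounded_integral => //; first exact: mIT.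
  by apply: ae_imp aeE => /= t + /andP[t0 _] => /(_ t0)[].
have DT T : 0 < T -> exists2 b, 0 <= b &
    (@lebesgue_measure R).-integrable `]0, T[ (EFin \o D) /\
    `|\int[lebesgue_measure]_(t in `]0, T[) D t| <= b * T.
  move=> T0; have [b hb] := bD T T0; exists `|b| => //.
  apply: ae_bounded_integral => //; first exact: mD.
  apply: ae_imp2 aeE hb => /= t ht hb tT; have [t0 _] := andP tT.
  have [_ D0 _] := ht t0; rewrite ger0_norm// (le_trans (hb tT))//.
  exact: ler_norm.
have bal T : 0 < T -> E T - E 0 = \int[lebesgue_measure]_(t in `]0, T[) P t -
    \int[lebesgue_measure]_(t in `]0, T[) D t.
  move=> T0; have [iP _] := PT T T0; have [b _ [iD _]] := DT T T0.
  rewrite -RintegralB//; apply: abs_continuous_FTC => //; first exact: acE.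
    exact: (integrableB _ iP iD).
  by apply: ae_imp aeE => /= t + /andP[t0 _] => /(_ t0)[].
have avgP T : 0 < T -> `|T^-1 * \int[lebesgue_measure]_(t in `]0, T[) P t| <= B.
  move=> T0; rewrite normrM gtr0_norm ?invr_gt0// mulrC ler_pdivrMr//.
  by have [_] := PT T T0.
split=> //.
  by move=> T T0; have [b _ []] := DT T T0.
have [b1 b10 hb1] : exists2 b, 0 <= b & forall T, 0 < T -> T <= 1 ->
    \int[lebesgue_measure]_(t in `]0, T[) D t <= b * T.
  have [b1 hb1] := bD 1 ltr01; exists `|b1| => // T T0 T1.
  apply: le_trans (ler_norm _) _; apply: (proj2 (ae_bounded_integral T0 _ _ _)) => //.
    exact: mD.
  apply: ae_imp2 aeE hb1 => /= t ht hb /andP[t0 tT].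
  have [_ D0 _] := ht t0; rewrite ger0_norm// (le_trans (hb _))//; last exact: ler_norm.
  by rewrite t0 (lt_le_trans tT).
(* b1 serves for T <= 1, and B + M, from the balance, for T > 1 *)
exists (Num.max b1 (B + M)) => T T0; rewrite le_max.
have [T1|T1] := leP T 1.
  by rewrite mulrC ler_pdivrMr// hb1.
apply/orP; right; have := avgP T T0; rewrite ler_norml => /andP[_ hP].
have -> : \int[lebesgue_measure]_(t in `]0, T[) D t =
    \int[lebesgue_measure]_(t in `]0, T[) P t - (E T - E 0).
  by rewrite bal//; ring.
have /andP[ET0 _] := E0M T (ltW T0); have /andP[E00 E0leM] := E0M 0 (lexx 0).
rewrite mulrBr lerD//; rewrite -mulrN mulrC ler_pdivrMr//.
have : M <= M * T by rewrite ler_peMr ?(le_trans E00)// ltW.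
by lra.
Qed.

(** * Estimates at a fixed time *)

(** Tonelli's theorem applied to the positive and negative parts; the
    integral is the difference of the two even when it diverges. *)
Lemma measurable_section_integral d1 d2 (T1 : measurableType d1)
    (T2 : measurableType d2) (R : realType)
    (mu : {sigma_finite_measure set T2 -> \bar R})
    (I : set T1) (D : set T2) (h : T1 * T2 -> R) :
  measurable I -> measurable D -> measurable_fun (I `*` D) h ->
  measurable_fun I (fun t => \int[mu]_(x in D) (h (t, x))%:E)%E.
Proof.
move=> mI mD mh.
have mID : measurable (I `*` D) by exact: measurableX.
pose k := (EFin \o h) \_ (I `*` D).
have mk : measurable_fun setT k.
  apply/measurable_restrict => //; rewrite setTI.
  exact/measurable_EFinP.
have := measurable_fun_fubini_tonelli_F (m2 := mu) _ (measurable_funeneg mk)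
  (fun x => funeneg_ge0 _ _).
have := measurable_fun_fubini_tonelli_F (m2 := mu) _ (measurable_funepos mk)
  (fun x => funepos_ge0 _ _).
move=> mpos mneg.
apply: (eq_measurable_fun (fun t => \int[mu]_x k (t, x))%E).
  move=> t; rewrite inE => It; rewrite [RHS]integral_mkcond.
  apply: eq_integral => x _; rewrite /k !patchE.
  have [Dx|nDx] := pselect (D x).
    by rewrite !mem_set.
  by rewrite !memNset// => -[].
apply: measurable_funTS.
have := emeasurable_funB mpos mneg; apply: eq_measurable_fun => t _.
by rewrite [RHS]integralE; congr (_ - _)%E; apply: eq_integral => x _;
  rewrite ?funeposE ?funenegE.
Qed.

Section model_coefficients.
Context (R : realType) (d : nat) (nu Cs delta : R) (nu0 : 0 < nu).
Implicit Types G : 'M[R]_d.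

Lemma acoef_sqr G :
  acoef nu Cs delta G ^+ 2 = (Cs * delta) ^+ 2 / nu * fnorm G.
Proof.
rewrite /acoef !exprMn sqr_sqrtr ?fnorm_ge0// exprVn sqr_sqrtr ?ltW//.
by ring.
Qed.

Lemma fnorm_acoef G (u : 'rV[R]_d) :
  fnorm (acoef nu Cs delta G *: u) ^+ 2 =
  (Cs * delta) ^+ 2 / nu * (fnorm G * fnorm u ^+ 2).
Proof. by rewrite fnormZ exprMn real_normK ?num_real// acoef_sqr mulrA. Qed.

Lemma nuT_ge0 G : 0 <= nuT Cs delta G.
Proof. by rewrite /nuT mulr_ge0 ?sqr_ge0 ?fnorm_ge0. Qed.

End model_coefficients.

Lemma Rintegral_le_of_integral d (T : measurableType d) (R : realType)
    (mu : {measure set T -> \bar R}) (D : set T) (g : T -> R) (b : R) :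
  (forall x, D x -> 0 <= g x) ->
  (\int[mu]_(x in D) (g x)%:E <= b%:E)%E ->
  \int[mu]_(x in D) g x <= b.
Proof.
move=> g0 gb; rewrite /Rintegral -lee_fin fineK//.
rewrite ge0_fin_numE; last by apply: integral_ge0 => x Dx; rewrite lee_fin g0.
by apply: le_lt_trans gb _; rewrite ltry.
Qed.

Section energy_versus_dissipation.
Context (R : realType) (d : nat) (Omega : set 'rV[R]_d) (nu Cs delta A B m x : R).
Context (nu0 : 0 < nu) (mO : measurable Omega)
  (mOE : lebesgue_rV R d Omega = m%:E).
Context (u : 'rV[R]_d -> 'rV[R]_d) (G : 'rV[R]_d -> 'M[R]_d)
  (mu : measurable_fun Omega u) (mG : measurable_fun Omega G)
  (intG : (\int[lebesgue_rV R d]_(y in Omega) (fnorm (G y) ^+ 3)%:E = x%:E)%E)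
  (intu : (\int[lebesgue_rV R d]_(y in Omega) (fnorm (u y) ^+ 3)%:E <=
           (A + B * x)%:E)%E).
Local Notation kappa := ((Cs * delta) ^+ 2).

Let mfu : measurable_fun Omega (fun y => fnorm (u y)).
Proof. by apply: measurable_fnorm; exact/measurable_mxP. Qed.

Let mfG : measurable_fun Omega (fun y => fnorm (G y)).
Proof. by apply: measurable_fnorm; exact/measurable_mxP. Qed.

Lemma kinetic_le : \int[lebesgue_rV R d]_(y in Omega) fnorm (u y) ^+ 2 <=
  m + A + B * x.
Proof.
apply: Rintegral_le_of_integral => [y _|]; first by rewrite sqr_ge0.
apply: le_trans (integral_sqr_le _ mO mfu _) _; first by move=> y; exact: fnorm_ge0.
by rewrite -addrA EFinD -mOE; exact: leeD2l.
Qed.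

(** The cubic nature of int |G| |u|^2 is what makes the L^3 norm of the
    gradient, hence the dissipation of the eddy viscosity, control it. *)
Lemma modelled_kinetic_le :
  \int[lebesgue_rV R d]_(y in Omega)
     fnorm (acoef nu Cs delta (G y) *: u y) ^+ 2 <=
  kappa / nu * (x + (A + B * x)).
Proof.
have k0 : 0 <= kappa / nu by rewrite divr_ge0 ?sqr_ge0 ?ltW.
apply: Rintegral_le_of_integral => [y _|]; first by rewrite sqr_ge0.
under eq_integral do rewrite fnorm_acoef// EFinM.
have mX3 (g : 'rV[R]_d -> R) : measurable_fun Omega g ->
    measurable_fun Omega (fun y => (g y ^+ 3)%:E).
  by move=> mg; apply/measurable_EFinP; exact: measurable_funX.
have mGu : measurable_fun Omega (fun y => (fnorm (G y) * fnorm (u y) ^+ 2)%:E).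
  apply/measurable_EFinP; apply: measurable_funM => //.
  exact: measurable_funX.
rewrite ge0_integralZl//; last first.
  by move=> y _; rewrite lee_fin mulr_ge0 ?fnorm_ge0 ?exprn_ge0 ?fnorm_ge0.
rewrite [leRHS]EFinM lee_wpmul2l ?lee_fin// EFinD -intG.
apply: (@le_trans _ _ (\int[lebesgue_rV R d]_(y in Omega)
    ((fnorm (G y) ^+ 3)%:E + (fnorm (u y) ^+ 3)%:E))%E).
  apply: ge0_le_integral => //.
  - by move=> y _; rewrite lee_fin mulr_ge0 ?fnorm_ge0 ?exprn_ge0 ?fnorm_ge0.
  - by apply: emeasurable_funD; exact: mX3.
  - move=> y _; rewrite -EFinD lee_fin; apply: mul_sqr_le_cubes;
      exact: fnorm_ge0.
rewrite ge0_integralD//; try exact: mX3.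
- by rewrite leeD2l.
- by move=> y _; rewrite lee_fin exprn_ge0 ?fnorm_ge0.
- by move=> y _; rewrite lee_fin exprn_ge0 ?fnorm_ge0.
Qed.

Lemma dissipation_bounds :
  (\int[lebesgue_rV R d]_(y in Omega)
     ((nu + nuT Cs delta (G y)) * frob (G y) (G y))%:E <=
   (nu * (m + x) + kappa * x)%:E)%E /\
  ((kappa * x)%:E <= \int[lebesgue_rV R d]_(y in Omega)
     ((nu + nuT Cs delta (G y)) * frob (G y) (G y))%:E)%E.
Proof.
have mX k : measurable_fun Omega (fun y => (fnorm (G y) ^+ k)%:E).
  by apply/measurable_EFinP; exact: measurable_funX.
have X0 k y : (0 <= (fnorm (G y) ^+ k)%:E)%E.
  by rewrite lee_fin exprn_ge0 ?fnorm_ge0.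
have k0 : (0 <= kappa%:E)%E by rewrite lee_fin sqr_ge0.
have nuE0 : (0 <= nu%:E)%E by rewrite lee_fin ltW.
have -> : (\int[lebesgue_rV R d]_(y in Omega)
     ((nu + nuT Cs delta (G y)) * frob (G y) (G y))%:E =
    nu%:E * \int[lebesgue_rV R d]_(y in Omega) (fnorm (G y) ^+ 2)%:E +
    kappa%:E * x%:E)%E.
  rewrite -intG -!ge0_integralZl// -ge0_integralD//.
  - apply: eq_integral => y _; rewrite -!EFinM -EFinD -fnorm_sqr /nuT.
    by congr EFin; ring.
  - by move=> y _; rewrite mule_ge0.
  - exact: measurable_funeM.
  - by move=> y _; rewrite mule_ge0.
  - exact: measurable_funeM.
split.
  rewrite !EFinD !EFinM leeD2r// lee_wpmul2l// EFinD -mOE -intG.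
  by apply: integral_sqr_le => // y; exact: fnorm_ge0.
rewrite EFinM leeDr// mule_ge0// integral_ge0// => y _; exact: X0.
Qed.

End energy_versus_dissipation.

Lemma ae_eq_Rintegral d (T : measurableType d) (R : realType)
    (mu : {measure set T -> \bar R}) (D : set T) (g h : T -> R) :
  measurable D -> measurable_fun D g -> measurable_fun D h ->
  {ae mu, forall x, D x -> g x = h x} ->
  \int[mu]_(x in D) g x = \int[mu]_(x in D) h x.
Proof.
move=> mD mg mh gh; rewrite /Rintegral; congr fine.
apply: ae_eq_integral => //; try exact/measurable_EFinP.
by apply: ae_imp gh => x /= gh Dx; rewrite gh.
Qed.

(** The momentum equation tested with w. The divergence constraint removes
    the convection and pressure terms after integration by parts, and moving
    a(w) from dtaw to w exhibits the derivative of |a(w) w|^2. *)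
Lemma momentum_balance (R : realType) (d : nat) (Omega : set 'rV[R]_d)
    (nu Cs delta beta : R) (f w wt dtaw Dp divS : 'rV[R]_d -> 'rV[R]_d)
    (p : 'rV[R]_d -> R) (G : 'rV[R]_d -> 'M[R]_d) :
  measurable Omega -> 0 < beta ->
  measurable_fun Omega w -> measurable_fun Omega G -> measurable_fun Omega p ->
  {ae lebesgue_rV R d, forall x, Omega x ->
     wt x + (beta ^+ 2 * acoef nu Cs delta (G x)) *: dtaw x +
     convection (w x) (G x) + Dp x - divS x = f x} ->
  {ae lebesgue_rV R d, forall x, Omega x -> \tr (G x) = 0} ->
  (lebesgue_rV R d).-integrable Omega (fun x =>
    (frob ((beta ^+ 2 * acoef nu Cs delta (G x)) *: dtaw x) (w x))%:E) ->
  [/\ (lebesgue_rV R d).-integrable Omega (fun x => (frob (wt x) (w x))%:E),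
      (lebesgue_rV R d).-integrable Omega
         (fun x => (frob (convection (w x) (G x)) (w x))%:E),
      (lebesgue_rV R d).-integrable Omega (fun x => (frob (Dp x) (w x))%:E),
      (lebesgue_rV R d).-integrable Omega (fun x => (frob (divS x) (w x))%:E) &
      (lebesgue_rV R d).-integrable Omega (fun x => (frob (f x) (w x))%:E)] ->
  \int[lebesgue_rV R d]_(x in Omega) frob (convection (w x) (G x)) (w x) =
    - (2^-1 * \int[lebesgue_rV R d]_(x in Omega)
                (\tr (G x) * fnorm (w x) ^+ 2)) ->
  \int[lebesgue_rV R d]_(x in Omega) frob (Dp x) (w x) =
    - (\int[lebesgue_rV R d]_(x in Omega) (p x * \tr (G x))) ->
  \int[lebesgue_rV R d]_(x in Omega) frob (divS x) (w x) =
    - (\int[lebesgue_rV R d]_(x in Omega)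
         frob (stress nu Cs delta (G x)) (G x)) ->
  \int[lebesgue_rV R d]_(x in Omega) frob (wt x) (w x) + beta ^+ 2 *
    \int[lebesgue_rV R d]_(x in Omega)
      frob (dtaw x) (acoef nu Cs delta (G x) *: w x) =
  \int[lebesgue_rV R d]_(x in Omega) frob (f x) (w x) -
  fine (\int[lebesgue_rV R d]_(x in Omega)
    ((nu + nuT Cs delta (G x)) * frob (G x) (G x))%:E)%E.
Proof.
move=> mO beta0 mw mG mp mom tr0 iq [iwt iconv iDp idivS i_f] ibpc ibpp ibps.
have b2 : beta ^+ 2 != 0 by rewrite expf_neq0// gt_eqF.
have mtr : measurable_fun Omega (fun x => \tr (G x)).
  by apply: measurable_sum => i; move/(measurable_mxP _ mO): mG; exact.
have mfw : measurable_fun Omega (fun x => fnorm (w x)).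
  by apply: measurable_fnorm; exact/measurable_mxP.
have conv0 : \int[lebesgue_rV R d]_(x in Omega)
    (\tr (G x) * fnorm (w x) ^+ 2) = 0.
  rewrite (@ae_eq_Rintegral _ _ _ _ _ _ (fun=> 0))//.
  - by rewrite Rintegral_cst// mul0r.
  - by apply: measurable_funM => //; exact: measurable_funX.
  - by apply: ae_imp tr0 => x /= tr0 Ox; rewrite tr0// mul0r.
have pres0 : \int[lebesgue_rV R d]_(x in Omega) (p x * \tr (G x)) = 0.
  rewrite (@ae_eq_Rintegral _ _ _ _ _ _ (fun=> 0))//.
  - by rewrite Rintegral_cst// mul0r.
  - exact: measurable_funM.
  - by apply: ae_imp tr0 => x /= tr0 Ox; rewrite tr0// mulr0.
have qE : beta ^+ 2 * \int[lebesgue_rV R d]_(x in Omega)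
      frob (dtaw x) (acoef nu Cs delta (G x) *: w x) =
    \int[lebesgue_rV R d]_(x in Omega)
      frob ((beta ^+ 2 * acoef nu Cs delta (G x)) *: dtaw x) (w x).
  have E x : frob (dtaw x) (acoef nu Cs delta (G x) *: w x) =
      (beta ^+ 2)^-1 *
      frob ((beta ^+ 2 * acoef nu Cs delta (G x)) *: dtaw x) (w x).
    by rewrite frobZl frobZr mulrA mulKf.
  rewrite (eq_Rintegral _ (fun x _ => E x)) RintegralZl//.
  by rewrite mulVKf.
have sE : \int[lebesgue_rV R d]_(x in Omega) frob (stress nu Cs delta (G x)) (G x) =
    fine (\int[lebesgue_rV R d]_(x in Omega)
      ((nu + nuT Cs delta (G x)) * frob (G x) (G x))%:E)%E.
  by apply: eq_Rintegral => x _; rewrite /stress frobZl.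
have fE : \int[lebesgue_rV R d]_(x in Omega) frob (f x) (w x) =
    \int[lebesgue_rV R d]_(x in Omega) (frob (wt x) (w x) +
      frob ((beta ^+ 2 * acoef nu Cs delta (G x)) *: dtaw x) (w x) +
      frob (convection (w x) (G x)) (w x) + frob (Dp x) (w x) -
      frob (divS x) (w x)).
  have mi (g : 'rV[R]_d -> R) :
      (lebesgue_rV R d).-integrable Omega (fun x => (g x)%:E) ->
      measurable_fun Omega g.
    by move=> /measurable_int /measurable_EFinP.
  apply: ae_eq_Rintegral => //.
  - exact: mi.
  - by apply: measurable_funB; [do !apply: measurable_funD|]; exact: mi.
  - by apply: ae_imp mom => x /= momx Ox; rewrite -momx// !frobDl frobNl.
have i1 := integrableD mO iwt iq.
have i2 := integrableD mO i1 iconv.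
have i3 := integrableD mO i2 iDp.
rewrite fE RintegralB// RintegralD// RintegralD// RintegralD//.
by rewrite qE ibpc ibpp ibps conv0 pres0 sE; ring.
Qed.

Lemma measurable_section d1 d2 d3 (T1 : measurableType d1)
    (T2 : measurableType d2) (T3 : measurableType d3)
    (I : set T1) (D : set T2) (h : T1 * T2 -> T3) t :
  measurable I -> measurable D -> measurable_fun (I `*` D) h -> I t ->
  measurable_fun D (fun x => h (t, x)).
Proof.
move=> mI mD mh It; apply: (measurable_comp (measurableX mI mD) _ mh).
  by move=> _ [x Dx <-].
exact: measurable_funTS.
Qed.

(** Young's inequality with a free weight e, to be chosen so that the term
    in u is absorbed by the dissipation. *)
Lemma power_young (R : realType) (d : nat) (Omega : set 'rV[R]_d)
    (g u : 'rV[R]_d -> 'rV[R]_d) (F e : R) :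
  measurable Omega -> measurable_fun Omega g -> measurable_fun Omega u ->
  (\int[lebesgue_rV R d]_(x in Omega) (fnorm (g x) ^+ 2)%:E <= F%:E)%E ->
  (\int[lebesgue_rV R d]_(x in Omega) (fnorm (u x) ^+ 2)%:E < +oo)%E ->
  0 < e ->
  `|\int[lebesgue_rV R d]_(x in Omega) frob (g x) (u x)| <=
    (2 * e)^-1 * F +
    e / 2 * \int[lebesgue_rV R d]_(x in Omega) fnorm (u x) ^+ 2.
Proof.
move=> mO mg mu gF ufin e0.
have fnorm2_ge0 (v : 'rV[R]_d -> 'rV[R]_d) x : (0 <= (fnorm (v x) ^+ 2)%:E)%E.
  by rewrite lee_fin sqr_ge0.
have ifn (v : 'rV[R]_d -> 'rV[R]_d) : measurable_fun Omega v ->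
    (\int[lebesgue_rV R d]_(x in Omega) (fnorm (v x) ^+ 2)%:E < +oo)%E ->
    (lebesgue_rV R d).-integrable Omega (fun x => (fnorm (v x) ^+ 2)%:E).
  move=> mv vfin; apply/integrableP; split.
    apply/measurable_EFinP; apply: measurable_funX; apply: measurable_fnorm.
    exact/measurable_mxP.
  by under eq_integral do rewrite gee0_abs//.
have ig := ifn _ mg (le_lt_trans gF (ltry _)); have iu := ifn _ mu ufin.
pose b x := (2 * e)^-1 * fnorm (g x) ^+ 2 + e / 2 * fnorm (u x) ^+ 2.
have ib : (lebesgue_rV R d).-integrable Omega (fun x => (b x)%:E).
  exact: (integrableD mO (integrableZl mO (2 * e)^-1 ig)
                         (integrableZl mO (e / 2) iu)).
have mfrob : measurable_fun Omega (fun x => frob (g x) (u x)).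
  by apply: measurable_frob; exact/measurable_mxP.
have d0 : 0 < (2 * e)^-1 by rewrite invr_gt0 mulr_gt0.
have b0 x : 0 <= b x.
  by rewrite /b addr_ge0// mulr_ge0 ?sqr_ge0 ?ltW// divr_gt0.
have ifrob : (lebesgue_rV R d).-integrable Omega (fun x => (frob (g x) (u x))%:E).
  apply: le_integrable ib => //; first exact/measurable_EFinP.
  by move=> x _ /=; rewrite lee_fin (ger0_norm (b0 x)); exact: frob_young.
apply: le_trans (le_normr_Rintegral mO ifrob) _.
apply: (@le_trans _ _ (\int[lebesgue_rV R d]_(x in Omega) b x)).
  apply: le_Rintegral => //; last by move=> x _; exact: frob_young.
  exact: (integrable_abse ifrob).
rewrite /b RintegralD//; last 2 first.
- exact: (integrableZl mO (2 * e)^-1 ig).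
- exact: (integrableZl mO (e / 2) iu).
rewrite !RintegralZl// lerD2r (ler_wpM2l (ltW d0))//.
by apply: Rintegral_le_of_integral => // x _; rewrite sqr_ge0.
Qed.

(** * Lower and upper limits *)

Lemma limf_einf_ge (R : realType) (g : R -> R) (l : R) :
  (forall e, 0 < e -> exists T0 : R, forall T, T0 < T -> l - e <= g T) ->
  (l%:E <= limf_einf (fun T => (g T)%:E) (pinfty_nbhs R))%E.
Proof.
move=> gl; apply/lee_subgt0Pr => e e0; have [T0 hT0] := gl e e0.
rewrite limf_einfE.
apply: (@le_trans _ _ (ereal_inf ((fun T => (g T)%:E) @` `]T0, +oo[))).
  apply: le_ereal_inf_tmp => _ [T + <-]; rewrite /= in_itv/= andbT => T0T.
  by rewrite -EFinB lee_fin hT0.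
apply: ereal_sup_ubound; exists `]T0, +oo[%classic => //.
by exists T0; split; [exact: num_real|move=> T; rewrite /= in_itv/= andbT].
Qed.

Lemma limf_esup_le (R : realType) (g : R -> R) (T0 b : R) :
  (forall T, T0 < T -> g T <= b) ->
  (limf_esup (fun T => (g T)%:E) (pinfty_nbhs R) <= b%:E)%E.
Proof.
move=> gb; rewrite limf_esupE.
apply: (@le_trans _ _ (ereal_sup ((fun T => (g T)%:E) @` `]T0, +oo[))).
  apply: ereal_inf_lbound; exists `]T0, +oo[%classic => //.
  by exists T0; split; [exact: num_real|move=> T; rewrite /= in_itv/= andbT].
apply: ge_ereal_sup => _ [T + <-]; rewrite /= in_itv/= andbT => T0T.
by rewrite lee_fin gb.
Qed.

Lemma limf_einf_le_esup (T : choiceType) (X : filteredType T) (R : realType)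
    (g : X -> \bar R) (F : set_system X) : ProperFilter F ->
  (limf_einf g F <= limf_esup g F)%E.
Proof.
move=> FF; rewrite limf_einfE limf_esupE.
apply: ge_ereal_sup => _ [V FV <-]; apply: le_ereal_inf_tmp => _ [W FW <-].
have [x [Vx Wx]] := filter_ex (filterI FV FW).
apply: (@le_trans _ _ (g x)).
  by apply: ereal_inf_lbound; exists x.
by apply: ereal_sup_ubound; exists x.
Qed.

(** * Energy estimates for strong solutions *)

Definition energy (R : realType) d (Omega : set 'rV[R]_d) nu Cs delta beta
    (w : R -> 'rV[R]_d -> 'rV[R]_d) (Dw : R -> 'rV[R]_d -> 'M[R]_d) (t : R) : R :=
  2^-1 * (\int[lebesgue_rV R d]_(x in Omega) fnorm (w t x) ^+ 2) +
  beta ^+ 2 / 2 * (\int[lebesgue_rV R d]_(x in Omega)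
                     fnorm (acoef nu Cs delta (Dw t x) *: w t x) ^+ 2).

Section strong_solutions.
Context (R : realType) (n : nat) (Omega : set 'rV[R]_n.+1)
  (nu Cs delta beta : R) (f : R -> 'rV[R]_n.+1 -> 'rV[R]_n.+1)
  (w0 : 'rV[R]_n.+1 -> 'rV[R]_n.+1) (w : R -> 'rV[R]_n.+1 -> 'rV[R]_n.+1)
  (p : R -> 'rV[R]_n.+1 -> R) (Dw : R -> 'rV[R]_n.+1 -> 'M[R]_n.+1)
  (wt dtaw Dp divS : R -> 'rV[R]_n.+1 -> 'rV[R]_n.+1).
Context (mO : measurable Omega) (bO : bounded_set Omega)
  (nu0 : 0 < nu) (Cs0 : 0 < Cs) (delta0 : 0 < delta) (beta0 : 0 < beta)
  (hf : in_Linf_Lq `]0, +oo[ 2 Omega f)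
  (hw : strong_solution Omega nu Cs delta beta f w0 w p Dw wt dtaw Dp divS).

Local Notation E := (energy Omega nu Cs delta beta w Dw).
Local Notation lbg := (lebesgue_rV R n.+1).
Local Notation diss := (dissipation Omega nu Cs delta Dw).

Let mI T : measurable (`]0, T[%classic : set (measurableTypeR R)).
Proof. exact: measurable_itv. Qed.

Let mIoo : measurable (`]0, +oo[%classic : set (measurableTypeR R)).
Proof. exact: measurable_itv. Qed.

Lemma measurable_velocity :
  measurable_fun ((`]0, +oo[ : set R) `*` Omega)
    (fun z : R * 'rV[R]_n.+1 => w z.1 z.2).
Proof.
apply/measurable_mxP; first exact: (measurableX mIoo).
by move=> i j; rewrite ord1; have [[]] := sol_wt hw j.
Qed.

Lemma measurable_scaled_velocity :
  measurable_fun ((`]0, +oo[ : set R) `*` Omega)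
    (fun z : R * 'rV[R]_n.+1 => acoef nu Cs delta (Dw z.1 z.2) *: w z.1 z.2).
Proof.
apply/measurable_mxP; first exact: (measurableX mIoo).
by move=> i j; rewrite ord1; have [[]] := sol_dtaw hw j.
Qed.

Lemma kinetic_fin (u : 'rV[R]_n.+1 -> 'rV[R]_n.+1) : in_Lq 2 Omega u ->
  (\int[lbg]_(x in Omega) (fnorm (u x) ^+ 2)%:E =
   (\int[lbg]_(x in Omega) fnorm (u x) ^+ 2)%:E)%E.
Proof.
move=> [_ hu]; rewrite /Rintegral fineK// ge0_fin_numE; last first.
  by apply: integral_ge0 => x _; rewrite lee_fin sqr_ge0.
have N0 : (0 <= Lq_norm 2 Omega (@fnorm R 1 n.+1 \o u))%E by exact: Lnorm_ge0.
have NE : (Lq_norm 2 Omega (@fnorm R 1 n.+1 \o u) =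
    (fine (Lq_norm 2 Omega (@fnorm R 1 n.+1 \o u)))%:E)%E.
  by rewrite fineK// ge0_fin_numE.
apply: le_lt_trans (ltry (fine (Lq_norm 2 Omega (@fnorm R 1 n.+1 \o u)) ^+ 2)).
by rewrite -Lq_norm_fnorm_le ?fine_ge0// -NE.
Qed.

Lemma gradient_cube_bounded (T : R) : 0 < T -> exists2 b, 0 <= b &
  {ae @lebesgue_measure R, forall t : R, 0 < t < T ->
    (\int[lbg]_(x in Omega) (fnorm (Dw t x) ^+ 3)%:E <= b%:E)%E}.
Proof.
move=> T0; have [_ [b hb]] := sol_Dw_L3 hw T0.
exists (`|b| ^+ 3) => //; apply: ae_imp hb => /= t hb tT.
have : (Lq_norm 3 Omega (@fnorm R n.+1 n.+1 \o Dw t) <= `|b|%:E)%E.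
  apply: le_trans (hb _) _; first by rewrite in_itv.
  by rewrite lee_fin ler_norm.
by rewrite Lq_norm_fnorm_le.
Qed.

Lemma measurable_dissipation T : measurable_fun (`]0, T[ : set R) diss.
Proof.
have [T0|T0] := ltP 0 T; last first.
  by rewrite set_itv_ge ?bnd_simp -?leNgt//; exact: measurable_fun_set0.
have [mDw _] := sol_Dw_L3 hw T0.
have mID : measurable ((`]0, T[%classic : set (measurableTypeR R)) `*` Omega).
  exact: measurableX.
apply: (@measurable_section_integral _ _ (measurableTypeR R) _ _ lbg _ _
  (fun z => (nu + nuT Cs delta (Dw z.1 z.2)) * frob (Dw z.1 z.2) (Dw z.1 z.2))) => //.
have mDij := (measurable_mxP _ mID).1 mDw.
apply: measurable_funM; last exact: measurable_frob.
apply: measurable_funD => //; apply: measurable_funM => //.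
exact: measurable_fnorm.
Qed.

Lemma measurable_power : measurable_fun (`]0, +oo[ : set R) (power Omega f w).
Proof.
have mID : measurable ((`]0, +oo[%classic : set (measurableTypeR R)) `*` Omega).
  exact: measurableX.
apply: (@measurableT_comp _ _ _ _ _ _ fine); first exact: fine_measurable.
apply: (@measurable_section_integral _ _ (measurableTypeR R) _ _ lbg _ _
  (fun z => frob (f z.1 z.2) (w z.1 z.2))) => //.
apply: measurable_frob; apply/(measurable_mxP _ mID).
  by have [] := hf.
exact: measurable_velocity.
Qed.

Lemma measurable_MD T :
  measurable_fun (`]0, T[ : set R) (MD Omega nu Cs delta beta w Dw dtaw).
Proof.
have [T0|T0] := ltP 0 T; last first.
  by rewrite set_itv_ge ?bnd_simp -?leNgt//; exact: measurable_fun_set0.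
have [mDw _] := sol_Dw_L3 hw T0.
have mID : measurable ((`]0, T[%classic : set (measurableTypeR R)) `*` Omega).
  exact: measurableX.
have sub : (`]0, T[%classic : set (measurableTypeR R)) `*` Omega `<=`
    (`]0, +oo[%classic : set (measurableTypeR R)) `*` Omega.
  by move=> [t x] /= [+ Ox]; rewrite !in_itv/= => /andP[t0 _]; split; rewrite ?t0.
apply: (@measurableT_comp _ _ _ _ _ _ fine); first exact: fine_measurable.
apply: (@measurable_section_integral _ _ (measurableTypeR R) _ _ lbg _ _
  (fun z => frob ((beta ^+ 2 * acoef nu Cs delta (Dw z.1 z.2)) *: dtaw z.1 z.2)
    (w z.1 z.2) + nuT Cs delta (Dw z.1 z.2) * fnorm (Dw z.1 z.2) ^+ 2)) => //.
have mfD : measurable_fun ((`]0, T[%classic : set (measurableTypeR R)) `*` Omega)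
    (fun z => fnorm (Dw z.1 z.2)).
  by apply: measurable_fnorm; apply/(measurable_mxP _ mID).
have msw : measurable_fun ((`]0, T[%classic : set (measurableTypeR R)) `*` Omega)
    (fun z => acoef nu Cs delta (Dw z.1 z.2) *: w z.1 z.2).
  apply: measurable_funS sub measurable_scaled_velocity.
  exact: (measurableX mIoo).
apply: measurable_funD; last first.
  by apply: measurable_funM; [exact: measurable_funM|exact: measurable_funX].
apply: (eq_measurable_fun (fun z => beta ^+ 2 *
    frob (dtaw z.1 z.2) (acoef nu Cs delta (Dw z.1 z.2) *: w z.1 z.2))).
  by move=> z _; rewrite frobZl frobZr mulrA.
apply: measurable_funM => //; apply: measurable_frob => i j; last first.
  by move/(measurable_mxP _ mID): msw; exact.
rewrite ord1; have [_ [mdt _] _] := sol_dtaw hw j.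
by apply: measurable_funS sub mdt; exact: (measurableX mIoo).
Qed.

(** The hypothesis on the gradient is local in time, so the exceptional null
    sets of the intervals ]0, k[ are collected over all k. *)
Lemma gradient_regular : {ae @lebesgue_measure R, forall t : R, 0 < t ->
  measurable_fun Omega (Dw t) /\
  exists2 x : R, 0 <= x &
    (\int[lbg]_(y in Omega) (fnorm (Dw t y) ^+ 3)%:E = x%:E)%E}.
Proof.
have loc : {ae @lebesgue_measure R, forall t : R, forall k : nat,
    exists b : R, 0 < t < k.+1%:R ->
    (\int[lbg]_(x in Omega) (fnorm (Dw t x) ^+ 3)%:E <= b%:E)%E}.
  apply: ae_foralln => k; have [b _ hb] := gradient_cube_bounded (ltr0Sn R k).
  by apply: ae_imp hb => /= t hb; exists b.
apply: ae_imp2 loc (sol_Dw hw) => /= t hb jac t0; split.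
  apply/(measurable_mxP _ mO) => i j.
  by have [_ [mij _] _] := jac t0 i j.
have [b hbt] := hb (Num.trunc t); exists (fine
  (\int[lbg]_(y in Omega) (fnorm (Dw t y) ^+ 3)%:E)%E).
  by apply: fine_ge0; apply: integral_ge0 => y _; rewrite lee_fin exprn_ge0// fnorm_ge0.
rewrite fineK// ge0_fin_numE; last first.
  by apply: integral_ge0 => y _; rewrite lee_fin exprn_ge0// fnorm_ge0.
apply: le_lt_trans (hbt _) (ltry _); rewrite t0/=.
by have /andP[] := truncn_itv (ltW t0).
Qed.

Lemma energy_ge0 t : 0 <= E t.
Proof.
rewrite /energy addr_ge0// mulr_ge0 ?invr_ge0 ?divr_ge0 ?sqr_ge0//.
  by apply: Rintegral_ge0 => x _; exact: sqr_ge0.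
by apply: Rintegral_ge0 => x _; exact: sqr_ge0.
Qed.

Lemma energy_abs_continuous : loc_abs_continuous E.
Proof.
move=> T T0; apply: abs_continuousD; first exact: sol_w_AC hw T T0.
exact: sol_aw_AC hw T T0.
Qed.

Lemma energy_derive : {ae @lebesgue_measure R, forall t : R, 0 < t ->
  is_derive t 1 E (power Omega f w t - fine (diss t))}.
Proof.
have := ae_and (ae_and (ae_and (sol_w_derive hw) (sol_aw_derive hw))
  (ae_and (sol_momentum hw) (sol_div0 hw)))
  (ae_and (ae_and (sol_MD_dtaw hw) (sol_test_integrable hw))
    (ae_and (ae_and gradient_regular (sol_Dp hw))
    (ae_and (sol_ibp_convection hw) (ae_and (sol_ibp_pressure hw)
      (sol_ibp_stress hw))))).
apply: ae_imp => /= t [[[dEw dEa] [mom tr0]]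
  [[iq itest] [[reg Dpt] [ibpc [ibpp ibps]]]]] t0.
have [mG _] := reg t0; have [mw _] := sol_w_L2 hw (ltW t0).
have mp : measurable_fun Omega (p t) by have [[]] := Dpt t0 ord0.
rewrite /power /dissipation -(momentum_balance mO beta0 mw mG mp (mom t0)
  (tr0 t0) (iq t0) (itest t0) (ibpc t0) (ibpp t0) (ibps t0)).
apply: (is_derive_eq (is_deriveD (is_deriveZ 2^-1 (dEw t0))
  (is_deriveZ (beta ^+ 2 / 2) (dEa t0)))).
by rewrite /GRing.scale/=; field.
Qed.

(** At almost every time x = int |grad w|^3 governs all the quantities of the
    balance: it bounds the energies from above, and the dissipation is
    comparable to it, up to the additive constant a. *)
Lemma dissipation_cube_bounds : exists a b : R, [/\ 0 <= a, 0 < b &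
  {ae @lebesgue_measure R, forall t : R, 0 < t ->
    exists2 x : R, 0 <= x &
      [/\ (\int[lbg]_(y in Omega) (fnorm (Dw t y) ^+ 3)%:E = x%:E)%E,
        (Cs * delta) ^+ 2 * x <= fine (diss t) <= a + b * x,
        diss t = (fine (diss t))%:E,
        \int[lbg]_(y in Omega) fnorm (w t y) ^+ 2 <= a + b * x &
        E t <= a + b * x]}].
Proof.
have [A [B [A0 B0 poin]]] := poincare_zero_trace mO bO.
have finO := lebesgue_rV_bounded mO bO.
pose m := fine (lbg Omega).
have m0 : 0 <= m by rewrite fine_ge0.
have mOE : lbg Omega = m%:E by rewrite fineK// ge0_fin_numE.
set kappa := (Cs * delta) ^+ 2; have k0 : 0 <= kappa by rewrite sqr_ge0.
have [s sE s0] : exists2 s, s = beta ^+ 2 / 2 * (kappa / nu) & 0 <= s.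
  by eexists => //; apply: mulr_ge0; apply: divr_ge0 => //;
    [exact: sqr_ge0|exact: ltW].
have nm0 : 0 <= nu * m by rewrite mulr_ge0// ltW.
have sA0 : 0 <= s * A by rewrite mulr_ge0.
have sB0 : 0 <= s * B by rewrite mulr_ge0// ltW.
exists ((m + A) * 2 + nu * m + s * A), (B * 2 + nu + kappa + s + s * B); split.
- by rewrite !addr_ge0// mulr_ge0// addr_ge0.
- by rewrite ltr_wpDr// ltr_wpDr// ltr_wpDr// addr_gt0// mulr_gt0.
apply: ae_imp2 gradient_regular (sol_boundary hw) => /= t reg zt t0.
have [mG [x x0 xE]] := reg t0; exists x => //.
have [mw _] := sol_w_L2 hw (ltW t0).
have wle : (\int[lbg]_(y in Omega) (fnorm (w t y) ^+ 3)%:E <= (A + B * x)%:E)%E.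
  by apply: le_trans (poin _ _ mw mG (zt t0)) _; rewrite xE.
have kin := kinetic_le mO mOE mw wle.
have mod_kin := modelled_kinetic_le Cs delta nu0 mO mw mG xE wle.
have [disU disL] := dissipation_bounds Cs delta nu0 mO mOE mG xE.
have disE : diss t = (fine (diss t))%:E.
  rewrite fineK// ge0_fin_numE; first by apply: le_lt_trans disU (ltry _).
  by apply: le_trans disL; rewrite lee_fin mulr_ge0.
rewrite -/(diss t) disE !lee_fin -/kappa in disU disL.
have Bx0 : 0 <= B * x by rewrite mulr_ge0// ltW.
have nx0 : 0 <= nu * x by rewrite mulr_ge0// ltW.
have kx0 : 0 <= kappa * x by rewrite mulr_ge0.
have sx0 : 0 <= s * x by rewrite mulr_ge0.
have sBx0 : 0 <= s * B * x by rewrite mulr_ge0.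
have E2 : beta ^+ 2 / 2 * (\int[lbg]_(y in Omega)
    fnorm (acoef nu Cs delta (Dw t y) *: w t y) ^+ 2) <= s * (x + (A + B * x)).
  by rewrite sE -[leRHS]mulrA ler_wpM2l// divr_ge0// sqr_ge0.
split=> //.
- by rewrite disL/=; move: disU; lra.
- by move: kin; lra.
- by rewrite /energy; move: kin E2; lra.
Qed.

(** The absorbing estimate. Young's inequality lets half of the dissipation
    absorb the power input, and the other half controls the energy. *)
Lemma energy_bounded : exists M, forall t, 0 <= t -> E t <= M.
Proof.
have [a [b [a0 b0 bounds]]] := dissipation_cube_bounds.
have [mf [F hF]] := hf.
set kappa := (Cs * delta) ^+ 2 in bounds.
have k0 : 0 < kappa by rewrite exprn_gt0// mulr_gt0.
(* e makes the contribution of |w|^2 to the power at most kappa x / 2, half of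
   the lower bound of the dissipation; c makes c E absorb the other half. *)
pose e := kappa / b; have e0 : 0 < e by rewrite divr_gt0.
pose c := kappa / (2 * b); have c0 : 0 < c by rewrite divr_gt0// mulr_gt0.
pose K := (2 * e)^-1 * `|F| ^+ 2 + e / 2 * a + c * a.
exists (Num.max (E 0) (K / c)).
apply: abs_continuous_absorbing => //; first exact: energy_abs_continuous.
apply: ae_imp2 (ae_and energy_derive bounds) hF => /= t [dE bnd] hFt t0.
exists (power Omega f w t - fine (diss t)); first exact: dE.
have [x x0 [_ /andP[disL _] _ kin Ex]] := bnd t0.
have tI : (`]0, +oo[%classic : set (measurableTypeR R)) t by rewrite /= in_itv/= t0.
have mft : measurable_fun Omega (f t).
  exact: (measurable_section (h := fun z => f z.1 z.2) mIoo mO mf tI).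
have [mw wfin] := sol_w_L2 hw (ltW t0).
have fF : (\int[lbg]_(y in Omega) (fnorm (f t y) ^+ 2)%:E <= (`|F| ^+ 2)%:E)%E.
  rewrite -Lq_norm_fnorm_le//; apply: le_trans (hFt _) _ => //.
  by rewrite lee_fin ler_norm.
have wfin2 : (\int[lbg]_(y in Omega) (fnorm (w t y) ^+ 2)%:E < +oo)%E.
  by rewrite (kinetic_fin (sol_w_L2 hw (ltW t0))) ltry.
have := power_young mO mft mw fF wfin2 e0.
rewrite ler_norml -/(power Omega f w t) => /andP[_ Ple].
have eb : e * b = kappa by rewrite /e divfK// gt_eqF.
have cb : c * b = kappa / 2 by rewrite /c; field; rewrite gt_eqF.
have kinE : e / 2 * (\int[lbg]_(y in Omega) fnorm (w t y) ^+ 2) <=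
    e / 2 * a + kappa / 2 * x.
  apply: (@le_trans _ _ (e / 2 * (a + b * x))).
    by rewrite ler_wpM2l// divr_ge0// ltW.
  by rewrite -eb; lra.
have cE : c * E t <= c * a + kappa / 2 * x.
  apply: (@le_trans _ _ (c * (a + b * x))).
    by rewrite ler_wpM2l// ltW.
  by rewrite mulrDr mulrA cb.
by rewrite /K; lra.
Qed.


Local Notation kin := (fun t => \int[lbg]_(x in Omega) fnorm (w t x) ^+ 2).
Local Notation kin_a := (fun t => \int[lbg]_(x in Omega)
  fnorm (acoef nu Cs delta (Dw t x) *: w t x) ^+ 2).

Lemma kinetic_bounded : exists2 M, 0 <= M & forall t, 0 <= t ->
  [/\ E t <= M, kin t <= M & kin_a t <= M].
Proof.
have [M hM] := energy_bounded.
have M0 : 0 <= M by apply: le_trans (hM 0 (lexx 0)); exact: energy_ge0.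
have b2 : 0 < beta ^+ 2 by exact: exprn_gt0.
have K0 : 0 <= 2 * M / beta ^+ 2 by rewrite divr_ge0 ?mulr_ge0// ltW.
exists (2 * M + 2 * M / beta ^+ 2) => [|t t0]; first by rewrite addr_ge0// mulr_ge0.
have Et := hM t t0.
have k0 : 0 <= kin t by apply: Rintegral_ge0 => x _; exact: sqr_ge0.
have ka0 : 0 <= beta ^+ 2 / 2 * kin_a t.
  rewrite mulr_ge0 ?divr_ge0 ?(ltW b2)//.
  by apply: Rintegral_ge0 => x _; exact: sqr_ge0.
have := Et; rewrite /energy => Et'; split; [lra|lra|].
apply: (@le_trans _ _ (2 * M / beta ^+ 2)); last by lra.
by rewrite ler_pdivlMr// mulrC; lra.
Qed.

Lemma power_bounded : exists2 B, 0 <= B &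
  {ae @lebesgue_measure R, forall t : R, 0 < t -> `|power Omega f w t| <= B}.
Proof.
have [M M0 hM] := kinetic_bounded.
have [mf [F hF]] := hf.
exists ((2 * 1)^-1 * `|F| ^+ 2 + 1 / 2 * M).
  by rewrite addr_ge0 ?mulr_ge0// invr_ge0 mulr_ge0.
apply: ae_imp hF => /= t hFt t0.
have tI : (`]0, +oo[%classic : set (measurableTypeR R)) t by rewrite /= in_itv/= t0.
have mft : measurable_fun Omega (f t).
  exact: (measurable_section (h := fun z => f z.1 z.2) mIoo mO mf tI).
have [mw _] := sol_w_L2 hw (ltW t0).
have fF : (\int[lbg]_(y in Omega) (fnorm (f t y) ^+ 2)%:E <= (`|F| ^+ 2)%:E)%E.
  rewrite -Lq_norm_fnorm_le//; apply: le_trans (hFt _) _ => //.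
  by rewrite lee_fin ler_norm.
have wfin2 : (\int[lbg]_(y in Omega) (fnorm (w t y) ^+ 2)%:E < +oo)%E.
  by rewrite (kinetic_fin (sol_w_L2 hw (ltW t0))) ltry.
apply: le_trans (power_young mO mft mw fF wfin2 ltr01) _.
by rewrite lerD2l ler_wpM2l ?divr_ge0//; have [] := hM t (ltW t0).
Qed.

Lemma dissipation_ge0 t : (0 <= diss t)%E.
Proof.
apply: integral_ge0 => x _; rewrite lee_fin mulr_ge0 ?frob_ge0//.
by rewrite addr_ge0 ?nuT_ge0// ltW.
Qed.

Lemma measurable_fine_dissipation T :
  measurable_fun (`]0, T[ : set R) (fun t => fine (diss t)).
Proof.
apply: (measurableT_comp (f := fine)); first exact: fine_measurable.
exact: measurable_dissipation.
Qed.

Lemma energy_balance :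
  [/\ forall T, 0 < T -> (@lebesgue_measure R).-integrable `]0, T[
        (EFin \o (fun t => fine (diss t))),
      forall T, 0 < T -> E T - E 0 =
        \int[lebesgue_measure]_(t in `]0, T[) power Omega f w t -
        \int[lebesgue_measure]_(t in `]0, T[) fine (diss t),
      exists B, forall T, 0 < T ->
        `|T^-1 * \int[lebesgue_measure]_(t in `]0, T[) power Omega f w t| <= B &
      exists C, forall T, 0 < T ->
        T^-1 * \int[lebesgue_measure]_(t in `]0, T[) fine (diss t) <= C].
Proof.
have [M M0 hM] := kinetic_bounded; have [B B0 hB] := power_bounded.
have [a [b [a0 b0 bounds]]] := dissipation_cube_bounds.
have [] := @dissipation_average R E (fun t => fine (diss t)) (power Omega f w) M B.
- exact: energy_abs_continuous.
- by move=> t t0; rewrite energy_ge0; have [] := hM t t0.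
- by move=> T _; exact: measurable_fine_dissipation.
- exact: measurable_power.
- exact: B0.
- apply: ae_imp2 energy_derive hB => /= t dE PB t0.
  by split; [exact: dE|exact/fine_ge0/dissipation_ge0|exact: PB].
- move=> T T0; have [c c0 hc] := gradient_cube_bounded T0.
  exists (a + b * c); apply: ae_imp2 bounds hc => /= t bnd hc tT.
  have [t0 _] := andP tT; have [x x0 [xE /andP[_ dle] _ _ _]] := bnd t0.
  apply: (le_trans dle); rewrite lerD2l ler_wpM2l ?(ltW b0)//.
  by have := hc tT; rewrite xE lee_fin.
by move=> h1 h2 h3 h4; split=> //; exists B.
Qed.

(** The dissipation is finite at almost every time only, hence the detour
    through its finite part. *)
Lemma avg_dissipationE T : 0 < T ->
  (T^-1%:E * \int[lebesgue_measure]_(t in `]0%R, T[) diss t)%E =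
  (T^-1 * \int[lebesgue_measure]_(t in `]0, T[) fine (diss t))%:E.
Proof.
move=> T0; have [iD _ _ _] := energy_balance.
have [a [b [_ _ bounds]]] := dissipation_cube_bounds.
rewrite EFinM; congr (_ * _)%E.
rewrite /Rintegral fineK; last exact: (integrable_fin_num (mI T) (iD T T0)).
apply: ge0_ae_eq_integral => //.
- exact: measurable_dissipation.
- by apply/measurable_EFinP; exact: measurable_fine_dissipation.
- by move=> t _; exact: dissipation_ge0.
- by move=> t _; rewrite lee_fin; exact/fine_ge0/dissipation_ge0.
apply: ae_imp bounds => /= t bnd; rewrite in_itv/= => /andP[t0 _].
by have [x _ []] := bnd t0.
Qed.

(** The time derivative term of MD is the exact derivative of
    beta^2/2 |a(w) w|^2, so only its boundary values enter the average. *)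
Lemma MD_integral T : 0 < T -> exists N : R,
  [/\ \int[lebesgue_measure]_(t in `]0, T[) MD Omega nu Cs delta beta w Dw dtaw t =
        beta ^+ 2 / 2 * (kin_a T - kin_a 0) + N,
      0 <= N & N <= \int[lebesgue_measure]_(t in `]0, T[) fine (diss t)].
Proof.
move=> T0; have [iD _ _ _] := energy_balance.
have [a [b [_ _ bounds]]] := dissipation_cube_bounds.
have b2 : beta ^+ 2 != 0 by rewrite expf_neq0// gt_eqF.
pose Q t := \int[lbg]_(x in Omega)
  frob ((beta ^+ 2 * acoef nu Cs delta (Dw t x)) *: dtaw t x) (w t x).
pose V t := \int[lbg]_(x in Omega)
  (nuT Cs delta (Dw t x) * fnorm (Dw t x) ^+ 2).
have iQ : (@lebesgue_measure R).-integrable `]0, T[ (EFin \o Q).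
  exact: sol_MD_dtaw_loc hw T T0.
have iV : (@lebesgue_measure R).-integrable `]0, T[ (EFin \o V).
  exact: sol_MD_nuT_loc hw T T0.
have V0 t : 0 <= V t.
  by apply: Rintegral_ge0 => x _; rewrite mulr_ge0 ?sqr_ge0 ?nuT_ge0.
exists (\int[lebesgue_measure]_(t in `]0, T[) V t); split.
- have -> : \int[lebesgue_measure]_(t in `]0, T[)
      MD Omega nu Cs delta beta w Dw dtaw t =
      \int[lebesgue_measure]_(t in `]0, T[) (Q t + V t).
    apply: (ae_eq_Rintegral (mI T)).
    + exact: measurable_MD.
    + by apply: measurable_funD; [move: iQ|move: iV] =>
        /measurable_int /measurable_EFinP.
    + apply: ae_imp2 (sol_MD_dtaw hw) (sol_MD_nuT hw) => /= t hq hv.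
      rewrite in_itv/= => /andP[t0 _].
      by rewrite /MD RintegralD//; [exact: hq|exact: hv].
  rewrite RintegralD//; congr (_ + _).
  have QE : kin_a T - kin_a 0 =
      \int[lebesgue_measure]_(t in `]0, T[) (2 / beta ^+ 2 * Q t).
    apply: (abs_continuous_FTC (F := kin_a)) => //.
    + exact: sol_aw_AC hw T T0.
    + exact: (integrableZl (mI T) (2 / beta ^+ 2) iQ).
    apply: ae_imp2 (sol_aw_derive hw) (sol_MD_dtaw hw) => /= t da hq /andP[t0 _].
    apply: (is_derive_eq (da t0)).
    have e x : frob (dtaw t x) (acoef nu Cs delta (Dw t x) *: w t x) =
        (beta ^+ 2)^-1 *
        frob ((beta ^+ 2 * acoef nu Cs delta (Dw t x)) *: dtaw t x) (w t x).
      by rewrite frobZl frobZr mulrA mulKf.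
    rewrite (eq_Rintegral _ (fun x _ => e x)) RintegralZl//; last exact: hq.
    by rewrite mulrA.
  rewrite QE RintegralZl// mulrA.
  rewrite (_ : beta ^+ 2 / 2 * (2 / beta ^+ 2) = 1) ?mul1r//.
  by field; rewrite gt_eqF.
- by apply: Rintegral_ge0 => t _; exact: V0.
- rewrite -lee_fin /Rintegral !fineK; last 2 first.
  + exact: (integrable_fin_num (mI T) (iD T T0)).
  + exact: (integrable_fin_num (mI T) iV).
  apply: ae_ge0_le_integral => //.
  + by move=> t _; rewrite lee_fin; exact: V0.
  + exact: measurable_int iV.
  + by move=> t _; rewrite lee_fin; exact/fine_ge0/dissipation_ge0.
  + exact: measurable_int (iD T T0).
  apply: ae_imp2 bounds (ae_and gradient_regular (sol_MD_nuT hw)) => /= t bnd [reg hv].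
  rewrite in_itv/= => /andP[t0 _]; have [x x0 [_ _ dE _ _]] := bnd t0.
  have [mG _] := reg t0.
  rewrite -dE /V /Rintegral fineK; last exact: (integrable_fin_num mO (hv t0)).
  apply: ge0_le_integral => //.
  + by move=> y _; rewrite lee_fin mulr_ge0 ?sqr_ge0 ?nuT_ge0.
  + exact: measurable_int (hv t0).
  + have mDij := (measurable_mxP _ mO).1 mG.
    apply/measurable_EFinP; apply: measurable_funM; last exact: measurable_frob.
    apply: measurable_funD => //; apply: measurable_funM => //.
    exact: measurable_fnorm.
  + move=> y _; rewrite lee_fin fnorm_sqr ler_wpM2r ?frob_ge0//.
    by rewrite lerDr ltW.
Qed.

End strong_solutions.

(** * Uniform bounds in L^2 and long-time averages *)

Lemma in_Linf_L2_of_kinetic (R : realType) n (Omega : set 'rV[R]_n)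
    (u : R -> 'rV[R]_n -> 'rV[R]_n) (M : R) : 0 <= M ->
  measurable_fun ((`]0, +oo[ : set R) `*` Omega)
    (fun z : R * 'rV[R]_n => u z.1 z.2) ->
  (forall t, 0 < t ->
    (\int[lebesgue_rV R n]_(x in Omega) (fnorm (u t x) ^+ 2)%:E <= M%:E)%E) ->
  in_Linf_Lq `]0, +oo[ 2 Omega u.
Proof.
move=> M0 mu hM; split=> //; exists (Num.sqrt M).
apply: aeW => t; rewrite /= in_itv/= andbT => t0.
by rewrite Lq_norm_fnorm_le ?sqrtr_ge0// sqr_sqrtr// hM.
Qed.

Theorem theorem3p2 (R : realType) (d : nat) (Omega : set 'rV[R]_d)
    (nu Cs delta beta : R) (f : R -> 'rV[R]_d -> 'rV[R]_d)
    (w0 : 'rV[R]_d -> 'rV[R]_d) (w : R -> 'rV[R]_d -> 'rV[R]_d)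
    (p : R -> 'rV[R]_d -> R) (Dw : R -> 'rV[R]_d -> 'M[R]_d)
    (wt dtaw Dp divS : R -> 'rV[R]_d -> 'rV[R]_d)
    (hd : d = 2%N \/ d = 3%N)
    (hOmega : domain Omega) (bOmega : bounded_set Omega)
    (nu_gt0 : 0 < nu) (Cs_gt0 : 0 < Cs) (delta_gt0 : 0 < delta)
    (beta_gt0 : 0 < beta)
    (hf : in_Linf_Lq `]0, +oo[ 2 Omega f) (hw0 : in_Lq 2 Omega w0)
    (hw : strong_solution Omega nu Cs delta beta f w0
            w p Dw wt dtaw Dp divS) :
  let avg_dissipation (T : R) : \bar R :=
    (T^-1%:E * \int[lebesgue_measure]_(t in `]0%R, T[)
                 dissipation Omega nu Cs delta Dw t)%E in
  let avg_power (T : R) : R :=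
    T^-1 * \int[lebesgue_measure]_(t in `]0, T[) power Omega f w t in
  let avg_MD (T : R) : R :=
    T^-1 * \int[lebesgue_measure]_(t in `]0, T[)
             MD Omega nu Cs delta beta w Dw dtaw t in
  [/\ in_Linf_Lq `]0, +oo[ 2 Omega w,
      in_Linf_Lq `]0, +oo[ 2 Omega
        (fun t x => acoef nu Cs delta (Dw t x) *: w t x),
      exists C : R, forall T : R, 0 < T -> (avg_dissipation T <= C%:E)%E,
      [/\ bounded_pos (fun T => fine (avg_dissipation T)),
          bounded_pos avg_power &
          forall LIM : (R -> R) -> R, generalized_limit LIM ->
            LIM (fun T => fine (avg_dissipation T)) = LIM avg_power] &
      [/\ (0 <= limf_einf (fun T => (avg_MD T)%:E) (pinfty_nbhs R))%E,
          (limf_einf (fun T => (avg_MD T)%:E) (pinfty_nbhs R) <=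
           limf_esup (fun T => (avg_MD T)%:E) (pinfty_nbhs R))%E &
          (limf_esup (fun T => (avg_MD T)%:E) (pinfty_nbhs R) < +oo)%E]].
Proof.
move=> avg_dissipation avg_power avg_MD.
have [n dn] : exists n, d = n.+1.
  by case: hd => ->; [exists 1%N|exists 2%N].
subst d; have [oO _ _] := hOmega; have mO := open_measurable_rV oO.
have [M M0 hM] :=
  kinetic_bounded mO bOmega nu_gt0 Cs_gt0 delta_gt0 beta_gt0 hf hw.
have [_ bal [B hB] [C hC]] :=
  energy_balance mO bOmega nu_gt0 Cs_gt0 delta_gt0 beta_gt0 hf hw.
have avgE T := @avg_dissipationE _ _ _ _ _ _ _ _ _ _ _ _ _ _ _ _
  mO bOmega nu_gt0 Cs_gt0 delta_gt0 beta_gt0 hf hw T.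
have mdI T := @MD_integral _ _ _ _ _ _ _ _ _ _ _ _ _ _ _ _
  mO bOmega nu_gt0 Cs_gt0 delta_gt0 beta_gt0 hf hw T.
have E0 t := energy_ge0 Omega nu Cs delta beta w Dw t.
pose dbar T := T^-1 * \int[lebesgue_measure]_(t in `]0, T[)
  fine (dissipation Omega nu Cs delta Dw t).
have avg_dbar T : 0 < T -> fine (avg_dissipation T) = dbar T.
  by move=> T0; rewrite /avg_dissipation avgE.
have dbar_ge0 T : 0 < T -> 0 <= dbar T.
  move=> T0; rewrite /dbar mulr_ge0 ?invr_ge0 ?(ltW T0)//.
  apply: Rintegral_ge0 => t _; apply: fine_ge0; exact: dissipation_ge0.
have C0 : 0 <= C by apply: le_trans (hC 1 ltr01); exact: dbar_ge0.
have bdiss : bounded_pos (fun T => fine (avg_dissipation T)).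
  by exists C => T T0; rewrite avg_dbar// ger0_norm ?dbar_ge0// hC.
have bpower : bounded_pos avg_power by exists B.
have diff T : 0 < T -> fine (avg_dissipation T) - avg_power T =
    - (T^-1 * (energy Omega nu Cs delta beta w Dw T -
               energy Omega nu Cs delta beta w Dw 0)).
  by move=> T0; rewrite avg_dbar// bal// /dbar /avg_power; ring.
split.
- apply: (in_Linf_L2_of_kinetic M0); first exact: measurable_velocity hw.
  move=> t t0; rewrite (kinetic_fin (sol_w_L2 hw (ltW t0))) lee_fin.
  by have [] := hM t (ltW t0).
- apply: (in_Linf_L2_of_kinetic M0); first exact: measurable_scaled_velocity hw.
  move=> t t0; rewrite (kinetic_fin (sol_aw_L2 hw (ltW t0))) lee_fin.
  by have [] := hM t (ltW t0).
- by exists C => T T0; rewrite /avg_dissipation avgE// lee_fin; exact: hC.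
- split=> // LIM LIMP.
  have := LIM_linear LIMP 1 (-1) bdiss bpower.
  rewrite (LIM_cvg LIMP (l := 0)).
  + by move=> h; lra.
  + have [b1 hb1] := bdiss; have [b2 hb2] := bpower.
    exists (b1 + b2) => T T0; rewrite mul1r mulN1r.
    by apply: le_trans (ler_normB _ _) _; rewrite lerD ?hb1 ?hb2.
  (* the two averages differ by (E(T) - E(0)) / T, at most M / T *)
  apply/cvgrPdist_lt => e e0; exists (M / e); split; first exact: num_real.
  move=> T MT; have T0 : 0 < T by apply: le_lt_trans MT; rewrite divr_ge0// ltW.
  rewrite sub0r normrN mul1r mulN1r diff// normrN normrM gtr0_norm ?invr_gt0//.
  rewrite mulrC ltr_pdivrMr//.
  rewrite ltr_pdivrMr// mulrC in MT; apply: le_lt_trans MT.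
  have [ET _ _] := hM T (ltW T0); have [E0M _ _] := hM 0 (lexx 0).
  by have := E0 T; have := E0 0; rewrite ler_norml; move=> *; apply/andP; split; lra.
pose c := beta ^+ 2 / 2 * M.
have c0 : 0 <= c by rewrite mulr_ge0 ?divr_ge0 ?sqr_ge0.
(* T times the average of MD: the time derivative contributes at most c in
   absolute value, the eddy viscosity between 0 and T C *)
have mdB T : 0 < T -> - c <= T * avg_MD T <= c + T * C.
  move=> T0; have [N [avE N0 NC]] := mdI T T0.
  pose k t := \int[lebesgue_rV R n.+1]_(x in Omega)
    fnorm (acoef nu Cs delta (Dw t x) *: w t x) ^+ 2.
  have kT : k T <= M by have [] := hM T (ltW T0).
  have k0 : k 0 <= M by have [] := hM 0 (lexx 0).
  rewrite /avg_MD mulVKf ?gt_eqF// avE -/(k T) -/(k 0).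
  have kge0 t : 0 <= k t by apply: Rintegral_ge0 => x _; exact: sqr_ge0.
  have NTC : N <= T * C.
    by apply: le_trans NC _; rewrite -ler_pdivrMl//; exact: hC.
  have b2 : 0 <= beta ^+ 2 / 2 by rewrite divr_ge0 ?sqr_ge0.
  have lo : beta ^+ 2 / 2 * (- M) <= beta ^+ 2 / 2 * (k T - k 0).
    by rewrite ler_wpM2l//; have := kge0 T; lra.
  have up : beta ^+ 2 / 2 * (k T - k 0) <= beta ^+ 2 / 2 * M.
    by rewrite ler_wpM2l//; have := kge0 0; lra.
  by rewrite /c; apply/andP; split; lra.
split.
- apply: limf_einf_ge => e e0; exists (c / e) => T cT.
  have T0 : 0 < T by apply: le_lt_trans cT; rewrite divr_ge0// ltW.
  have /andP[h _] := mdB T T0.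
  rewrite sub0r -(ler_pM2l T0); apply: le_trans h.
  by rewrite mulrN lerN2; move: cT; rewrite ltr_pdivrMr// => /ltW.
- exact: limf_einf_le_esup.
- apply: le_lt_trans (ltry (c + C)); apply: (limf_esup_le (T0 := 1)) => T T1.
  have T0 : 0 < T by exact: lt_trans T1.
  have /andP[_ h] := mdB T T0; rewrite -(ler_pM2l T0); apply: (le_trans h).
  by rewrite mulrDr lerD2r ler_peMl// ltW.
Qed.
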